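(* Let $n\ge 2$, $b>0$, and let $p_0,\dots,p_{n-2}$ be complex-valued, $C^\infty$, $b$-periodic functions on $\mathbb{R}$. Consider $\mathcal{L}u := u^{(n)}+\sum_{k=0}^{n-2}p_k(x)u^{(k)}$ and the equation $\mathcal{L}u=\lambda u$, $\lambda\in\mathbb{C}$. Let $u_1(x;\lambda),\dots,u_n(x;\lambda)$ be the fundamental solutions, i.e. the solutions with $u_j^{(i-1)}(0;\lambda)=\delta_{ij}$ for $i,j=1,\dots,n$, let $T(\lambda)=[t_{ij}(\lambda)]_{1\le i,j\le n}$ with $t_{ij}(\lambda)=u_j^{(i-1)}(b;\lambda)$ (the Floquet matrix), and let $P(r;\lambda)=\det[rI-T(\lambda)]$. Then $P(r;\lambda)$, regarded as a polynomial in $r$ whose coefficients are entire functions of $\lambda$, is irreducible over the field $\mathcal{M}(\mathbb{C})$ of meromorphic functions on $\mathbb{C}$.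
   Context: Here $u^{(k)}$ denotes the $k$-th derivative in $x$. The entries $t_{ij}(\lambda)$ are entire functions of $\lambda$, so $P(r;\lambda)\in\mathcal{M}(\mathbb{C})[r]$ is monic of degree $n$. *)

(* Defs.v *)
From HB Require Import structures.
From mathcomp Require Import all_boot all_order all_algebra.
From mathcomp Require Import all_classical all_reals all_analysis.
From mathcomp Require Import complex.
Import Order.TTheory GRing.Theory Num.Theory.
Import numFieldNormedType.Exports.

Set Implicit Arguments.
Unset Strict Implicit.
Unset Printing Implicit Defensive.

Local Open Scope ring_scope.
Local Open Scope classical_set_scope.

Section Defs.
Variable R : realType.

(* the complex plane as a normed space over itself (so that
   [derivable f z 1] is complex differentiability and [z^'] is the
   punctured neighbourhood filter) *)
Definition Cx : Type := (R[i])^o.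

Definition re_part (f : R -> R[i]) : R -> R := fun x => complex.Re (f x).
Definition im_part (f : R -> R[i]) : R -> R := fun x => complex.Im (f x).

Definition cder (f : R -> R[i]) : R -> R[i] :=
  fun x => Complex ((re_part f)^`() x) ((im_part f)^`() x).

Definition cdern (k : nat) (f : R -> R[i]) : R -> R[i] := iter k cder f.

Definition cdifferentiable (f : R -> R[i]) : Prop :=
  forall x : R, derivable (re_part f) x 1 /\ derivable (im_part f) x 1.

Definition cdiffn (n : nat) (f : R -> R[i]) : Prop :=
  forall k, (k < n)%N -> cdifferentiable (cdern k f).

Definition csmooth (f : R -> R[i]) : Prop := forall n, cdiffn n f.

Definition is_Lsol (n : nat) (p : nat -> R -> R[i]) (lam : R[i])
    (u : R -> R[i]) : Prop :=
  cdiffn n u /\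
  forall x : R,
    cdern n u x + \sum_(k < n.-1) p k x * cdern k u x = lam * u x.

Definition floquet (n : nat) (b : R) (u : nat -> R[i] -> R -> R[i])
    (lam : R[i]) : 'M[R[i]]_n :=
  \matrix_(i < n, j < n) cdern i (u j lam) b.

Definition closed_discrete (S : set Cx) : Prop :=
  forall z : Cx, \forall w \near z^', ~ S w.

(* f is meromorphic on C: holomorphic off a closed discrete set S, and each
   point of S is at worst a pole (the values of f on S are irrelevant). *)
Definition meromorphic (f : Cx -> Cx) : Prop :=
  exists S : set Cx,
    [/\ closed_discrete S,
        (forall z : Cx, ~ S z -> derivable f z 1) &
        (forall s : Cx, S s -> exists (m : nat) (l : Cx),
            (w - s) ^+ m * f w @[w --> s^'] --> l)].

(* P(r; lam), a polynomial of degree n in r with coefficients depending on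
   lam, is irreducible over the field M(C) of meromorphic functions: it is
   not a product of two polynomials in M(C)[r] of positive degrees
   (necessarily of degrees d1, d2 with d1 + d2 = n); equality in M(C)[r]
   means coefficientwise equality off a closed discrete set. *)
Definition mero_irreducible (n : nat) (P : Cx -> {poly R[i]}) : Prop :=
  ~ exists d1 d2 : nat,
      [/\ (0 < d1)%N, (0 < d2)%N, (d1 + d2 = n)%N &
      exists q r : nat -> Cx -> Cx,
        [/\ forall k, meromorphic (q k),
            forall k, meromorphic (r k) &
            exists S : set Cx, closed_discrete S /\
              forall lam : Cx, ~ S lam ->
                P lam = \poly_(k < d1.+1) q k lam * \poly_(k < d2.+1) r k lam]].

End Defs.

(* Main.v *)
(* Put lam = mu^n with |mu| = rho large. A Floquet multiplier x of lam is a
   ratio y(b)/y(0) for a solution y; diagonalizing the companion system turns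
   L y = lam y into n scalar equations v_j' = a_j v_j + f with a_j = zeta^j mu,
   zeta = exp(2 pi i/n), and f = O(sum |v_j| / rho), because the term of order
   n - 1 is missing from L. Hence x lies in one of the n discs of small
   relative radius centred at exp(b zeta^j mu). For suitable arbitrarily large
   rho these discs are disjoint for every mu on the circle |mu| = rho, and the
   circle |lam| = rho^n avoids a given closed discrete set.

   Let now Q be a factor of P of degree d1. Its coefficients are continuous
   along that circle, so for mu = rho exp(i phi) the number of roots of Q in
   the disc centred at exp(b mu) is a locally constant, hence constant,
   function of phi. When phi increases by 2 pi/n, lam comes back to its value
   while the discs are permuted cyclically, so all n discs contain the same
   number of roots of Q. Thus n divides d1, which is impossible for
   0 < d1 < n. *)
Require Import Defs.
From HB Require Import structures.
From mathcomp Require Import all_boot all_order all_algebra.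
From mathcomp Require Import all_classical all_reals all_analysis.
From mathcomp Require Import complex.
From mathcomp Require Import ring lra zify.
Import Order.TTheory GRing.Theory Num.Theory.
Import numFieldNormedType.Exports.
Local Open Scope ring_scope.
Local Open Scope classical_set_scope.

Set Implicit Arguments.
Unset Strict Implicit.
Unset Printing Implicit Defensive.

(** * Modulus, exponential and differentiation of complex-valued functions of a real variable *)

Section ComplexModulus.
Variable R : realType.
Implicit Types (z w : R[i]) (x y : R).

(* The modulus with values in R: the library norm of R[i] takes its values in
   R[i], which is only partially ordered. *)
Definition nc z : R := Normc.normc z.

Lemma ncE z : nc z = Num.sqrt (complex.Re z ^+ 2 + complex.Im z ^+ 2).
Proof. by case: z. Qed.

Lemma normr_ncE z : `|z| = (nc z)%:C%C.
Proof. by []. Qed.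

Lemma nc_ge0 z : 0 <= nc z.
Proof. by rewrite ncE sqrtr_ge0. Qed.

Lemma ncM z w : nc (z * w) = nc z * nc w.
Proof. exact: Normc.normcM. Qed.

Lemma ncD z w : nc (z + w) <= nc z + nc w.
Proof. exact: le_normcD. Qed.

Lemma ncN z : nc (- z) = nc z.
Proof. exact: normcN. Qed.

Lemma ncB z w : nc (z - w) = nc (w - z).
Proof. by rewrite -ncN opprB. Qed.

Lemma nc0 : nc 0 = 0.
Proof. exact: Normc.normc0. Qed.

Lemma nc1 : nc 1 = 1.
Proof. exact: Normc.normc1. Qed.

Lemma ncX z n : nc (z ^+ n) = nc z ^+ n.
Proof. by elim: n => [|n IH]; rewrite ?expr0 ?nc1 // !exprS ncM IH. Qed.

Lemma nc_eq0 z : (nc z == 0) = (z == 0).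
Proof. by apply/eqP/eqP => [/Normc.eq0_normc|->] //; exact: nc0. Qed.

Lemma nc_gt0 z : (0 < nc z) = (z != 0).
Proof. by rewrite lt0r nc_eq0 nc_ge0 andbT. Qed.

Lemma nc_real x : nc x%:C%C = `|x|.
Proof. by rewrite ncE /= expr0n addr0 sqrtr_sqr. Qed.

Lemma nc_sum (I : finType) (F : I -> R[i]) :
  nc (\sum_i F i) <= \sum_i nc (F i).
Proof.
apply: (big_ind2 (fun z x => nc z <= x)) => [|z x w y zx wy|//].
  by rewrite nc0.
exact: le_trans (ncD _ _) (lerD zx wy).
Qed.

Lemma Re_le_nc z : `|complex.Re z| <= nc z.
Proof. by rewrite ncE -sqrtr_sqr ler_wsqrtr // lerDl sqr_ge0. Qed.

Lemma Im_le_nc z : `|complex.Im z| <= nc z.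
Proof. by rewrite ncE -sqrtr_sqr ler_wsqrtr // lerDr sqr_ge0. Qed.

Lemma nc_le_ReIm z : nc z <= `|complex.Re z| + `|complex.Im z|.
Proof.
rewrite {1}[z]complexE; apply: (le_trans (ncD _ _)).
by rewrite ncM !nc_real -[X in X * _]/(nc (Complex 0 1)) ncE /= expr0n expr1n add0r sqrtr1 mul1r.
Qed.

Lemma Re_mulc z w : complex.Re (z * w) =
  complex.Re z * complex.Re w - complex.Im z * complex.Im w.
Proof. by case: z; case: w. Qed.

Lemma Im_mulc z w : complex.Im (z * w) =
  complex.Re z * complex.Im w + complex.Im z * complex.Re w.
Proof. by case: z => a b; case: w => c d /=. Qed.

Lemma Re_addc z w : complex.Re (z + w) = complex.Re z + complex.Re w.
Proof. by case: z; case: w. Qed.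

Lemma Im_addc z w : complex.Im (z + w) = complex.Im z + complex.Im w.
Proof. by case: z; case: w. Qed.

Definition cexp z : R[i] :=
  (expR (complex.Re z))%:C%C * Complex (cos (complex.Im z)) (sin (complex.Im z)).

Definition cis x : R[i] := Complex (cos x) (sin x).

Lemma cisD x y : cis (x + y) = cis x * cis y.
Proof.
apply/eqP; rewrite eq_complex /= cosD sinD eqxx /=.
by rewrite addrC [X in _ + X]mulrC mulrC [X in _ + X]mulrC.
Qed.

Lemma cis0 : cis 0 = 1.
Proof. by rewrite /cis cos0 sin0. Qed.

Lemma cisX x n : cis x ^+ n = cis (n%:R * x).
Proof.
elim: n => [|n IH]; first by rewrite mul0r cis0.
by rewrite exprS IH -cisD -natr1 mulrDl mul1r addrC.
Qed.

Lemma nc_cis x : nc (cis x) = 1.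
Proof. by rewrite ncE /= cos2Dsin2 sqrtr1. Qed.

Lemma cis2pi : cis (2 * pi) = 1.
Proof. by rewrite /cis mulr_natl cos2pi sin2pi. Qed.

(** Half-angle formula: [cos x = 1] would force [sin (x / 2) = 0], while [x / 2] lies strictly
    between 0 and [pi]. *)
Lemma cis_neq1 x : 0 < x < 2 * pi -> cis x != 1.
Proof.
move=> /andP[x0 x2]; apply/negP => /eqP /(congr1 (@complex.Re R)) /=.
have -> : x = (x / 2) *+ 2 by rewrite -mulr_natr divfK.
rewrite cos_mulr2n cos2sin2.
have : 0 < sin (x / 2) by apply: sin_gt0_pi; lra.
move: (sin _) => s s0 E.
have : s ^+ 2 = 0 by rewrite mulr2n in E; lra.
by move/eqP; rewrite sqrf_eq0 gt_eqF.
Qed.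

Lemma cexpE z : cexp z = (expR (complex.Re z))%:C%C * cis (complex.Im z).
Proof. by []. Qed.

Lemma cexpD z w : cexp (z + w) = cexp z * cexp w.
Proof. by rewrite !cexpE Re_addc Im_addc expRD cisD rmorphM /= mulrACA. Qed.

Lemma cexp0 : cexp 0 = 1.
Proof. by rewrite cexpE /= expR0 cis0 mulr1. Qed.

Lemma nc_cexp z : nc (cexp z) = expR (complex.Re z).
Proof. by rewrite cexpE ncM nc_cis mulr1 nc_real gtr0_norm ?expR_gt0. Qed.

Lemma cexp_neq0 z : cexp z != 0.
Proof. by rewrite -nc_gt0 nc_cexp expR_gt0. Qed.

Lemma cexpN z : cexp (- z) = (cexp z)^-1.
Proof. by apply: (mulfI (cexp_neq0 z)); rewrite -cexpD subrr cexp0 divff ?cexp_neq0. Qed.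

(** Componentwise, to agree with [cder]; existence and value of the derivative are packed
    together. *)
Definition is_cder (f : R -> R[i]) (x : R) (l : R[i]) :=
  is_derive x 1 (fun t => complex.Re (f t)) (complex.Re l) /\
  is_derive x 1 (fun t => complex.Im (f t)) (complex.Im l).

Lemma is_cderD f g x l m : is_cder f x l -> is_cder g x m ->
  is_cder (fun t => f t + g t) x (l + m).
Proof.
move=> [fr fi] [gr gi]; split.
  rewrite (_ : (fun t => _) =
     (fun t => complex.Re (f t)) + (fun t => complex.Re (g t))); last first.
    by apply/funext => t; rewrite Re_addc.
  by rewrite Re_addc; apply: is_deriveD.
rewrite (_ : (fun t => _) = (fun t => complex.Im (f t)) + (fun t => complex.Im (g t))); last first.
  by apply/funext => t; rewrite Im_addc.
by rewrite Im_addc; apply: is_deriveD.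
Qed.

Lemma is_cderM f g x l m : is_cder f x l -> is_cder g x m ->
  is_cder (fun t => f t * g t) x (l * g x + f x * m).
Proof.
move=> [fr fi] [gr gi]; split.
  rewrite (_ : (fun t => _) =
     (fun t => complex.Re (f t)) * (fun t => complex.Re (g t))
     - (fun t => complex.Im (f t)) * (fun t => complex.Im (g t))); last first.
    by apply/funext => t; rewrite Re_mulc.
  apply: is_derive_eq; rewrite /= Re_addc !Re_mulc /GRing.scale /=; ring.
rewrite (_ : (fun t => _) =
     (fun t => complex.Re (f t)) * (fun t => complex.Im (g t))
     + (fun t => complex.Im (f t)) * (fun t => complex.Re (g t))); last first.
  by apply/funext => t; rewrite Im_mulc.
apply: is_derive_eq; rewrite /= Im_addc !Im_mulc /GRing.scale /=; ring.
Qed.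

Lemma is_cder_cst z x : is_cder (fun=> z) x 0.
Proof. by split; exact: is_derive_cst. Qed.

Lemma is_cderZ f x l z : is_cder f x l -> is_cder (fun t => z * f t) x (z * l).
Proof.
move=> fl; have := is_cderM (is_cder_cst z x) fl.
by rewrite mul0r add0r.
Qed.

Lemma is_cder_sum (I : finType) (f : I -> R -> R[i]) x (l : I -> R[i]) :
  (forall i, is_cder (f i) x (l i)) ->
  is_cder (fun t => \sum_i f i t) x (\sum_i l i).
Proof.
move=> fl.
elim: (index_enum I) => [|i s IH].
  rewrite (_ : (fun t => _) = fun=> 0) ?big_nil; first exact: is_cder_cst.
  by apply/funext => t; rewrite big_nil.
rewrite (_ : (fun t => _) = fun t => f i t + \sum_(j <- s) f j t); last first.
  by apply/funext => t; rewrite big_cons.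
by rewrite big_cons; apply: is_cderD.
Qed.

Lemma is_cder_cexp z x : is_cder (fun t => cexp (z * t%:C%C)) x (z * cexp (z * x%:C%C)).
Proof.
have Ere t : complex.Re (z * t%:C%C) = complex.Re z * t by rewrite Re_mulc /= mulr0 subr0.
have Eim t : complex.Im (z * t%:C%C) = complex.Im z * t by rewrite Im_mulc /= mulr0 add0r.
have dm (a : R) : is_derive x 1 (fun t : R => a * t) a.
  have := @is_deriveZ _ _ _ (@id R) a x 1 1 _.
  by rewrite /GRing.scale /= mulr1; apply.
have de := @is_derive1_comp _ (@expR R) (fun t : R => complex.Re z * t) x _ _
  (is_derive_expR _) (dm _).
have dc := @is_derive1_comp _ (@cos R) (fun t : R => complex.Im z * t) x _ _
  (is_derive_cos _) (dm _).
have ds := @is_derive1_comp _ (@sin R) (fun t : R => complex.Im z * t) x _ _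
  (is_derive_sin _) (dm _).
have := is_cderM (f := fun t => (expR (complex.Re z * t))%:C%C)
   (g := fun t => cis (complex.Im z * t)) (x := x)
   (l := (expR (complex.Re z * x) * complex.Re z)%:C%C)
   (m := Complex (- sin (complex.Im z * x) * complex.Im z)
            (cos (complex.Im z * x) * complex.Im z)).
have -> : z * cexp (z * x%:C%C) =
  (expR (complex.Re z * x) * complex.Re z)%:C%C * cis (complex.Im z * x) +
  (expR (complex.Re z * x))%:C%C *
    Complex (- sin (complex.Im z * x) * complex.Im z)
            (cos (complex.Im z * x) * complex.Im z).
  rewrite cexpE Ere Eim; case: z {Ere Eim de dc ds} => a c /=.
  apply/eqP; rewrite eq_complex /=; apply/andP; split; apply/eqP; ring.
under [fun t => cexp _]funext => t do rewrite cexpE Ere Eim.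
apply; first by split => //=; exact: is_derive_cst.
by split.
Qed.

End ComplexModulus.

(** * A priori estimates for the scalar equation [w' = a w + f] *)

Section Estimates.
Variable R : realType.

Lemma real_increment_le (f df : R -> R) (K x y : R) : x <= y ->
  (forall t : R, is_derive t 1 f (df t)) ->
  (forall t, x <= t <= y -> `|df t| <= K) -> `|f y - f x| <= K * (y - x).
Proof.
move=> xy fd dK.
have cf : {within `[x, y], continuous f}.
  by apply: derivable_within_continuous => t _; have := fd t => -[].
have [c cxy ->] := @MVT_segment _ f df x y xy (fun t _ => fd t) cf.
rewrite normrM (ger0_norm (x := y - x)) ?subr_ge0 //.
by apply: ler_wpM2r; rewrite ?subr_ge0 //; apply: dK; rewrite in_itv in cxy.
Qed.

(** The mean value theorem needs real values, so it is applied to the real and imaginary parts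
    separately; hence the factor 2. *)
Lemma increment_le (f df : R -> R[i]) (K x y : R) : x <= y ->
  (forall t : R, is_cder f t (df t)) ->
  (forall t, x <= t <= y -> nc (df t) <= K) ->
  nc (f y - f x) <= 2 * K * (y - x).
Proof.
move=> xy fd dK; apply: (le_trans (nc_le_ReIm _)).
have re := @real_increment_le (fun t => complex.Re (f t)) (fun t => complex.Re (df t)) K x y xy
  (fun t => (fd t).1) (fun t h => le_trans (Re_le_nc _) (dK t h)).
have im := @real_increment_le (fun t => complex.Im (f t)) (fun t => complex.Im (df t)) K x y xy
  (fun t => (fd t).2) (fun t h => le_trans (Im_le_nc _) (dK t h)).
have -> : complex.Re (f y - f x) = complex.Re (f y) - complex.Re (f x).
  by rewrite Re_addc; case: (f x).
have -> : complex.Im (f y - f x) = complex.Im (f y) - complex.Im (f x).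
  by rewrite Im_addc; case: (f x).
lra.
Qed.

Lemma Re_mul_real (z : R[i]) (x : R) : complex.Re (z * x%:C%C) = complex.Re z * x.
Proof. by rewrite Re_mulc /= mulr0 subr0. Qed.

Lemma Re_oppc (z : R[i]) : complex.Re (- z) = - complex.Re z.
Proof. by case: z. Qed.

Section ScalarEstimate.
Variables (a r : R[i]) (b sg M eps : R) (w f : R -> R[i]).
Hypothesis b0 : 0 < b.
Hypothesis eps0 : 0 < eps.
Hypothesis dw : forall x, is_cder w x (a * w x + f x).
Hypothesis fM : forall x, 0 <= x <= b -> nc (f x) <= M * expR (sg * x).
Hypothesis wb : w b = r * w 0.

(** Integrating factor: the term [a * w] disappears, and on [[0, b]] the derivative of [g] has
    modulus at most [M * expR ((sg - Re a) * t)]. *)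
Let g t := cexp (- a * t%:C%C) * w t.

Let dg t : is_cder g t (cexp (- a * t%:C%C) * f t).
Proof.
have -> : cexp (- a * t%:C%C) * f t =
  (- a * cexp (- a * t%:C%C)) * w t + cexp (- a * t%:C%C) * (a * w t + f t).
  by ring.
by apply: is_cderM; [exact: is_cder_cexp|exact: dw].
Qed.

Let wg t : w t = cexp (a * t%:C%C) * g t.
Proof. by rewrite /g mulrA -cexpD mulNr subrr cexp0 mul1r. Qed.

Let M0 : 0 <= M.
Proof.
have := fM (x := 0); rewrite lexx ltW // mulr0 expR0 mulr1 => /(_ isT).
exact: le_trans (nc_ge0 _).
Qed.

Let incr x y s : 0 <= x -> x <= y -> y <= b ->
  (forall t, x <= t <= y -> (sg - complex.Re a) * t <= s) ->
  nc (g y - g x) <= 2 * b * M * expR s.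
Proof.
move=> x0 xy yb hs.
apply: (le_trans (@increment_le _ _ (M * expR s) x y xy dg _)).
  move=> t txy; rewrite ncM nc_cexp Re_mul_real Re_oppc mulNr.
  have tb : 0 <= t <= b by lra.
  apply: (@le_trans _ _ (expR (- (complex.Re a * t)) * (M * expR (sg * t)))).
    by rewrite ler_wpM2l ?expR_ge0 // fM.
  rewrite mulrCA -expRD ler_wpM2l // ler_expR.
  have := hs _ txy; lra.
have := mulr_ge0 M0 (expR_ge0 s); set k := M * expR s => k0.
have -> : 2 * b * M * expR s = 2 * k * b by rewrite /k; ring.
by apply: ler_wpM2l; [rewrite mulr_ge0|lra].
Qed.

Let g0 : g 0 = w 0.
Proof. by rewrite /g mulr0 cexp0 mul1r. Qed.

(** Integration forward from 0, the direction in which the bound on the derivative of [g] increases.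
    At [x = b] the quantity estimated by [diff] is [(r - cexp (a b)) * w 0], so the separation of
    [r] from [cexp (a b)] controls [w 0], and then [w x]. *)
Lemma quasiperiodic_estimate_decaying :
  complex.Re a <= sg ->
  eps * expR (sg * b) <= nc (r - cexp (a * b%:C%C)) ->
  forall x, 0 <= x <= b -> nc (w x) <= 2 * b * M * (1 + eps^-1) * expR (sg * x).
Proof.
move=> asg sep.
have diff x : 0 <= x <= b -> nc (w x - cexp (a * x%:C%C) * w 0) <= 2 * b * M * expR (sg * x).
  move=> /andP[x0 xb].
  rewrite wg -g0 -mulrBr ncM nc_cexp Re_mul_real.
  have gx : nc (g x - g 0) <= 2 * b * M * expR ((sg - complex.Re a) * x).
    by apply: incr => // t /andP[_ tx]; rewrite ler_wpM2l ?subr_ge0.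
  have := ler_wpM2l (expR_ge0 (complex.Re a * x)) gx.
  by rewrite mulrCA -expRD mulrBl [complex.Re a * x + _]addrC subrK.
have w0 : nc (w 0) <= 2 * b * M * eps^-1.
  have := diff b; rewrite lexx ltW // wb -mulrBl ncM => /(_ isT) h.
  have /le_trans/(_ h) := ler_wpM2r (nc_ge0 (w 0)) sep.
  by rewrite mulrAC ler_pM2r ?expR_gt0 // mulrC ler_pdivlMr.
move=> x xb.
rewrite -[w x](subrK (cexp (a * x%:C%C) * w 0)).
apply: (le_trans (ncD _ _)).
rewrite mulrDr mulr1 mulrDl lerD ?diff // ncM nc_cexp Re_mul_real mulrC.
apply: ler_pM; rewrite ?nc_ge0 ?expR_ge0 // ler_expR ler_wpM2r //.
by case/andP: xb.
Qed.

(** Mirror case, integrated backward from [b], where [g b] plays the role of [w 0]. The bound on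
    [nc r] turns the estimate of [w 0] into one of [g b]. *)
Lemma quasiperiodic_estimate_growing :
  sg <= complex.Re a -> nc r <= expR (sg * b) ->
  eps * expR (complex.Re a * b) <= nc (r - cexp (a * b%:C%C)) ->
  forall x, 0 <= x <= b -> nc (w x) <= 2 * b * M * (1 + eps^-1) * expR (sg * x).
Proof.
move=> asg rs sep.
have diff x : 0 <= x <= b -> nc (g b - g x) <= 2 * b * M * expR ((sg - complex.Re a) * x).
  move=> /andP[x0 xb]; apply: incr => // t /andP[xt _].
  by rewrite ler_wnM2l // subr_le0.
have gb : g b = cexp (- a * b%:C%C) * r * w 0 by rewrite /g wb mulrA.
have w0 : nc (w 0) <= 2 * b * M * eps^-1.
  have := diff 0; rewrite lexx ltW // g0 mulr0 expR0 mulr1 => /(_ isT).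
  have -> : g b - w 0 = cexp (- a * b%:C%C) * ((r - cexp (a * b%:C%C)) * w 0).
    by rewrite gb mulNr cexpN mulrBl mulrBr mulKf ?cexp_neq0 // mulrA.
  rewrite ncM nc_cexp Re_mul_real Re_oppc mulNr ncM => h.
  rewrite -ler_pdivrMr ?invr_gt0 // invrK.
  apply: le_trans h.
  have /(ler_wpM2l (expR_ge0 (- (complex.Re a * b)))) := ler_wpM2r (nc_ge0 (w 0)) sep.
  apply: le_trans.
  by rewrite expRN [eps * _]mulrC -[expR _ * _ * _]mulrA mulKf ?gt_eqF ?expR_gt0 // mulrC.
move=> x xb; rewrite wg.
have -> : g x = g b - (g b - g x) by ring.
rewrite ncM nc_cexp Re_mul_real.
have gbx : nc (g b) <= expR ((sg - complex.Re a) * x) * (2 * b * M * eps^-1).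
  rewrite gb ncM; apply: ler_pM; rewrite ?nc_ge0 //.
  rewrite ncM nc_cexp Re_mul_real Re_oppc.
  apply: (@le_trans _ _ (expR (- complex.Re a * b) * expR (sg * b))).
    by rewrite ler_wpM2l ?expR_ge0.
  rewrite -expRD ler_expR -mulrDl addrC ler_wnM2l ?subr_le0 //.
  by case/andP: xb.
have := diff x xb.
have := ncD (g b) (- (g b - g x)); rewrite ncN.
move=> h1 h2.
have h3 : nc (g b - (g b - g x)) <= 2 * b * M * (1 + eps^-1) * expR ((sg - complex.Re a) * x).
  by apply: (le_trans h1); rewrite mulrDr mulr1 mulrDl addrC lerD // mulrC.
have /(ler_wpM2l (expR_ge0 (complex.Re a * x)))/le_trans := h3; apply.
by rewrite mulrCA -expRD mulrBl [complex.Re a * x + _]addrC subrK.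
Qed.

End ScalarEstimate.
End Estimates.

(** * Index arithmetic *)

Lemma add_succ_pred_sub (k l n : nat) : (l <= k)%N -> (k < n)%N ->
  (k.+1 + (n.-1 - l) = n + (k - l))%N.
Proof. lia. Qed.

Lemma add_succ_pred_sub_lt (k l n : nat) : (k < l)%N -> (l < n)%N ->
  (0 < k.+1 + (n.-1 - l) < n)%N.
Proof. lia. Qed.

Lemma leq_pred_sum (k l m n : nat) : (k <= m)%N -> (l <= n)%N ->
  ((k + l).-1 <= (m + n).-1)%N.
Proof. lia. Qed.

Lemma ltn_pred_trans (k n : nat) : (k < n.-1)%N -> (k < n)%N.
Proof. lia. Qed.

Lemma subnSS_succ (k m : nat) : (k < m)%N -> (m - k.+1).+1 = (m - k)%N.
Proof. lia. Qed.

(** * Localization of the Floquet multipliers *)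

Section RootsOfUnity.
Variable R : realType.

Definition zeta (n : nat) : R[i] := cis (2 * pi / n%:R).

Lemma zetaXn n : (0 < n)%N -> zeta n ^+ n = 1.
Proof.
by move=> n0; rewrite cisX mulrC divfK ?cis2pi // pnatr_eq0 -lt0n.
Qed.

Lemma nc_zetaX n k : nc (zeta n ^+ k) = 1.
Proof. by rewrite ncX nc_cis expr1n. Qed.

Lemma zetaX_neq1 n k : (0 < k < n)%N -> zeta n ^+ k != 1.
Proof.
move=> /andP[k0 kn]; rewrite cisX; apply: cis_neq1.
have n0 : (0 : R) < n%:R by rewrite ltr0n; lia.
have p0 := pi_gt0 R.
rewrite mulr_gt0 ?ltr0n ?divr_gt0 ?mulr_gt0 //=.
by rewrite mulrCA gtr_pMr ?mulr_gt0 // ltr_pdivrMr // mul1r ltr_nat.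
Qed.

(** Geometric sum: its product with [zeta n ^+ e - 1] is [zeta n ^+ (e * n) - 1 = 0]. *)
Lemma sum_zeta n e : (0 < n)%N -> zeta n ^+ e != 1 ->
  \sum_(j < n) zeta n ^+ (j * e) = 0.
Proof.
move=> n0 e1; have := subrXX (zeta n ^+ e) 1 n.
rewrite expr1n exprAC zetaXn // expr1n subrr => /esym/eqP.
rewrite mulf_eq0 subr_eq0 (negbTE e1) /= => /eqP E.
rewrite -[RHS]E (reindex_inj rev_ord_inj) /=; apply: eq_bigr => j _.
by rewrite expr1n mulr1 mulnC exprM subnS -subn1 subnAC subn1.
Qed.

End RootsOfUnity.

Section Localization.
Variable R : realType.

Lemma is_cder_continuous (f df : R -> R[i]) :
  (forall x : R, is_cder f x (df x)) -> continuous (fun x => nc (f x)).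
Proof.
move=> fd x.
have cre : {for x, continuous (fun t => complex.Re (f t))}.
  by apply/differentiable_continuous/derivable1_diffP; have := (fd x).1 => -[].
have cim : {for x, continuous (fun t => complex.Im (f t))}.
  by apply/differentiable_continuous/derivable1_diffP; have := (fd x).2 => -[].
under [fun t => nc _]funext => t do rewrite ncE !expr2.
apply: (@continuous_comp _ _ _
  (fun t => complex.Re (f t) * complex.Re (f t) + complex.Im (f t) * complex.Im (f t))
  (@Num.sqrt R)); last exact: sqrt_continuous.
by apply: cvgD; apply: cvgM.
Qed.

(* The weight is chosen so that expR (sg * b) is the modulus of r; any very
   negative sg will do if r = 0. *)
Lemma weight_exists (a : nat -> R[i]) (r : R[i]) (b eps rho : R) (n : nat) :
  0 < b -> eps <= 1 -> (forall j, (j < n)%N -> nc (a j) <= rho) ->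
  (forall j, (j < n)%N -> eps * Num.max (nc r) (nc (cexp (a j * b%:C%C)))
     <= nc (r - cexp (a j * b%:C%C))) -> 0 < eps ->
  exists sg : R, forall j, (j < n)%N ->
    (complex.Re (a j) <= sg /\
       eps * expR (sg * b) <= nc (r - cexp (a j * b%:C%C))) \/
    [/\ sg <= complex.Re (a j), nc r <= expR (sg * b) &
       eps * expR (complex.Re (a j) * b) <= nc (r - cexp (a j * b%:C%C))].
Proof.
move=> b0 e1 arho sep e0; have [r0|r0] := eqVneq r 0.
  exists (- rho) => j jn; right; split.
  - have := Re_le_nc (a j); have := arho j jn.
    by rewrite lerNl; move=> h1 h2; have := ler_norm (- complex.Re (a j)); rewrite normrN; lra.
  - by rewrite r0 nc0 expR_ge0.
  - rewrite r0 sub0r ncN nc_cexp Re_mul_real.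
    by rewrite ger_pMl ?expR_gt0.
exists (ln (nc r) / b) => j jn.
have E : expR (ln (nc r) / b * b) = nc r.
  by rewrite divfK ?gt_eqF // lnK // posrE nc_gt0.
rewrite E; have h := sep j jn.
case: (leP (complex.Re (a j)) (ln (nc r) / b)) => h'; [left|right]; split=> //.
- apply: le_trans h; rewrite ler_wpM2l ?(ltW e0) //.
  by rewrite le_max lexx.
- exact: ltW.
- apply: le_trans h; rewrite ler_wpM2l ?(ltW e0) //.
  by rewrite le_max nc_cexp Re_mul_real lexx orbT.
Qed.

Section System.
Variables (n : nat) (b : R) (p : nat -> R -> R[i]) (y : nat -> R -> R[i]).
Variables (lam mu r : R[i]) (eps P : R).
Hypothesis n0 : (0 < n)%N.
Hypothesis b0 : 0 < b.
Hypothesis dy : forall k (x : R), (k < n)%N -> is_cder (y k) x (y k.+1 x).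
Hypothesis ode : forall x, y n x + \sum_(k < n.-1) p k x * y k x = lam * y 0%N x.
Hypothesis muX : mu ^+ n = lam.
Hypothesis mu1 : 1 <= nc mu.

(* The v j are the coordinates given by the left eigenvectors of the companion
   matrix of the unperturbed equation. *)
Let z := zeta R n.
Let a j := z ^+ j * mu.
Let v j x := \sum_(k < n) a j ^+ (n.-1 - k) * y k x.
Let f x := - \sum_(k < n.-1) p k x * y k x.

Let aX j : a j ^+ n = lam.
Proof. by rewrite exprMn muX exprAC zetaXn // expr1n mul1r. Qed.

(** Multiplication by [a j] raises every exponent by one; the top term becomes [lam * y 0], which
    the equation turns into [y n] plus the lower-order terms cancelled by [f]. *)
Let dv j (x : R) : is_cder (v j) x (a j * v j x + f x).
Proof.
have -> : a j * v j x + f x = \sum_(k < n) a j ^+ (n.-1 - k) * y k.+1 x.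
  rewrite /v /f; move: (ode x) (aX j) n0; case: n => // m /= odex aXm _.
  rewrite [RHS]big_ord_recr [X in a j * X]big_ord_recl /=.
  rewrite subnn subn0 expr0 mul1r mulrDr mulrA -exprS aXm.
  rewrite -odex addrAC addrK addrC; congr (_ + _).
  rewrite mulr_sumr; apply: eq_bigr => k _; rewrite mulrA -exprS.
  by rewrite subnSS_succ.
by apply: is_cder_sum => k; apply: is_cderZ; exact: dy.
Qed.

(** Discrete Fourier inversion: the coefficient of [y l] is a sum of powers of [z ^+ (n + k - l)], a
    root of unity equal to 1 only for [l = k]. *)
Let inversion k x : (k < n)%N ->
  n%:R * (mu ^+ (n.-1 - k) * y k x) = \sum_(j < n) z ^+ (j * k.+1) * v j x.
Proof.
move=> kn.
have -> : \sum_(j < n) z ^+ (j * k.+1) * v j x =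
  \sum_(l < n) mu ^+ (n.-1 - l) * y l x * \sum_(j < n) z ^+ (j * (k.+1 + (n.-1 - l))).
  under eq_bigr do rewrite mulr_sumr; rewrite exchange_big /=.
  apply: eq_bigr => l _; rewrite mulr_sumr; apply: eq_bigr => j _.
  by rewrite exprMn -exprM mulnDr exprD -[X in _ * X = _]mulrA mulrA mulrC.
rewrite (bigD1 (Ordinal kn)) //= [X in _ + X]big1 ?addr0 => [|l lk].
  rewrite mulrC; congr (_ * _).
  rewrite (eq_bigr (fun=> 1)) ?sumr_const ?card_ord // => j _.
  by rewrite add_succ_pred_sub // subnn addn0 mulnC exprM zetaXn ?expr1n.
rewrite sum_zeta ?mulr0 //.
have lk' : (nat_of_ord l == k) = false by apply: contraNF lk => /eqP lk; apply/eqP/val_inj.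
have ln := ltn_ord l.
case: (ltngtP l k) lk' => // h _.
  rewrite add_succ_pred_sub ?(ltnW h) // exprD zetaXn // mul1r zetaX_neq1 //.
  by rewrite subn_gt0 h (leq_ltn_trans (leq_subr _ _) kn).
by apply: zetaX_neq1; exact: add_succ_pred_sub_lt.
Qed.

Let V x := \sum_(j < n) nc (v j x).

Let y_bound k x : (k < n)%N -> n%:R * (nc mu ^+ (n.-1 - k) * nc (y k x)) <= V x.
Proof.
move=> kn; have /(congr1 (@nc R)) := inversion x kn.
have -> : (n%:R : R[i]) = (n%:R : R)%:C%C by rewrite rmorph_nat.
rewrite !ncM ncX nc_real normr_nat => ->.
apply: (le_trans (nc_sum _)); apply: ler_sum => j _.
by rewrite ncM nc_zetaX mul1r.
Qed.

Hypothesis pP : forall k x, (k < n.-1)%N -> 0 <= x <= b -> nc (p k x) <= P.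
Hypothesis P0 : 0 <= P.
Hypothesis yb : forall k, (k < n)%N -> y k b = r * y k 0.
Hypothesis eps0 : 0 < eps.
Hypothesis eps1 : eps <= 1.
Hypothesis sep : forall j, (j < n)%N ->
  eps * Num.max (nc r) (nc (cexp (z ^+ j * mu * b%:C%C)))
    <= nc (r - cexp (z ^+ j * mu * b%:C%C)).
Hypothesis mu_large : n%:R * (2 * b * (1 + eps^-1) * P) < nc mu.

(** The absence of a term of order [n - 1] enters here: only [y k] with [k <= n - 2] occur, and for
    these [y_bound] carries at least one factor [nc mu]. *)
Let f_bound x : 0 <= x <= b -> nc (f x) <= P / nc mu * V x.
Proof.
move=> xb; rewrite ncN.
have mu0 : 0 < nc mu := lt_le_trans ltr01 mu1.
have nn0 : (0 : R) < n%:R by rewrite ltr0n.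
have V0 : 0 <= V x by apply: sumr_ge0 => j _; exact: nc_ge0.
apply: (le_trans (nc_sum _)).
apply: (@le_trans _ _ (\sum_(k < n.-1) P / nc mu * V x / n%:R)).
  apply: ler_sum => k _; have kn := ltn_ord k.
  rewrite ncM -!mulrA; apply: ler_pM; rewrite ?nc_ge0 ?pP //.
  have kn' := ltn_pred_trans kn.
  have h := y_bound x kn'.
  rewrite ler_pdivlMl // ler_pdivlMr // mulrC; apply: le_trans h.
  rewrite ler_wpM2l ?(ltW nn0) // ler_wpM2r ?nc_ge0 //.
  by apply: ler_eXnr; rewrite ?subn_gt0.
rewrite sumr_const card_ord -[_ *+ n.-1]mulr_natr -[X in X <= _]mulrA ler_piMr //.
  by rewrite mulr_ge0 // divr_ge0 // ltW.
by rewrite mulrC ler_pdivrMr // mul1r ler_nat leq_pred.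
Qed.

(** At a maximum point [c] of the weighted sum [G], the term [f] is at most [P / nc mu * G c] in the
    weight. The scalar estimates, summed over [j], then bound [G c] by a multiple of itself whose
    factor is below 1 by [mu_large]. Thus [G c = 0], and the solution vanishes at 0 with its
    derivatives. *)
Lemma no_multiplier_off_discs k : (k < n)%N -> y k 0 = 0.
Proof.
have mu0 : 0 < nc mu := lt_le_trans ltr01 mu1.
have nn0 : (0 : R) < n%:R by rewrite ltr0n.
have [sg sgP] : exists sg : R, forall j, (j < n)%N ->
    (complex.Re (a j) <= sg /\
       eps * expR (sg * b) <= nc (r - cexp (a j * b%:C%C))) \/
    [/\ sg <= complex.Re (a j), nc r <= expR (sg * b) &
       eps * expR (complex.Re (a j) * b) <= nc (r - cexp (a j * b%:C%C))].
  apply: (@weight_exists a r b eps (nc mu) n) => // j _.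
  by rewrite ncM nc_zetaX mul1r.
pose G x := V x * expR (- sg * x).
have cG : continuous G.
  move=> x; apply: cvgM.
    rewrite /V; apply: cvg_big; last by move=> j _; exact: is_cder_continuous (dv j) x.
    exact: add_continuous.
  apply: (@continuous_comp _ _ _ (fun t => - sg * t) (@expR R)); last exact: continuous_expR.
  by apply: cvgM; [exact: cvg_cst|exact: cvg_id].
have [c cb cmax] := EVT_max (ltW b0) (continuous_subspaceT cG).
have VG x : V x = G x * expR (sg * x).
  by rewrite /G -mulrA -expRD mulNr addNr expR0 mulr1.
have G0 : 0 <= G c.
  by rewrite mulr_ge0 ?expR_ge0 //; apply: sumr_ge0 => j _; exact: nc_ge0.
have fM x : 0 <= x <= b -> nc (f x) <= P / nc mu * G c * expR (sg * x).
  move=> xb; apply: (le_trans (f_bound xb)); rewrite VG mulrA.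
  by rewrite ler_wpM2r ?expR_ge0 // ler_wpM2l ?divr_ge0 ?(ltW mu0) // cmax // in_itv.
have vb j : v j b = r * v j 0.
  by rewrite mulr_sumr; apply: eq_bigr => l _; rewrite yb // mulrCA.
have vM j x : (j < n)%N -> 0 <= x <= b ->
    nc (v j x) <= 2 * b * (P / nc mu * G c) * (1 + eps^-1) * expR (sg * x).
  move=> jn xb; case: (sgP j jn) => [[h1 h2]|[h1 h2 h3]].
    exact: (quasiperiodic_estimate_decaying b0 eps0 (dv j) fM (vb j) h1 h2 xb).
  exact: (quasiperiodic_estimate_growing b0 eps0 (dv j) fM (vb j) h1 h2 h3 xb).
have cb' : 0 <= c <= b by move: cb; rewrite in_itv.
have Gc : G c <= n%:R * (2 * b * (1 + eps^-1) * P) / nc mu * G c.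
  rewrite {1}/G mulNr expRN ler_pdivrMr ?expR_gt0 //.
  apply: (@le_trans _ _ (\sum_(j < n) 2 * b * (P / nc mu * G c) * (1 + eps^-1) * expR (sg * c))).
    by apply: ler_sum => j _; exact: vM.
  rewrite sumr_const card_ord -mulr_natr le_eqVlt; apply/orP; left; apply/eqP; ring.
have Gc0 : G c = 0.
  apply/eqP; rewrite eq_le G0 andbT leNgt; apply/negP => Gp.
  move: Gc; rewrite -[X in X <= _]mul1r ler_pM2r // ler_pdivlMr // mul1r.
  by rewrite leNgt mu_large.
move=> kn.
have : V 0 <= G c.
  by rewrite VG mulr0 expR0 mulr1 cmax // in_itv /= lexx ltW.
rewrite Gc0; have := y_bound 0 kn => /le_trans h /h.
rewrite pmulr_rle0 // pmulr_rle0 ?exprn_gt0 // => h'.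
by apply/eqP; rewrite -nc_eq0 eq_le h' nc_ge0.
Qed.

End System.
End Localization.

(** * Continuity of roots and monodromy *)

Section RootsContinuity.
Variable R : realType.
Implicit Types (P Q D : {poly R[i]}) (s : seq R[i]).

(** If every root were at distance at least [th], the product of the [size s] distances would be at
    least [th ^+ size s]. *)
Lemma near_root s (z : R[i]) (th : R) : 0 <= th ->
  nc (\prod_(x <- s) ('X - x%:P)).[z] < th ^+ size s ->
  exists2 x, x \in s & nc (z - x) < th.
Proof.
move=> th0; elim: s => [|x s IH] /=.
  by rewrite big_nil hornerC nc1 expr0 ltxx.
rewrite big_cons hornerM hornerXsubC ncM exprS => h.
have [zx|zx] := ltP (nc (z - x)) th; first by exists x => //; exact: mem_head.
have [y ys zy] : exists2 y, y \in s & nc (z - y) < th.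
  apply: IH; rewrite ltNge; apply/negP => h'.
  by move: h; rewrite ltNge => /negP; apply; apply: ler_pM => //; exact: exprn_ge0.
by exists y => //; rewrite in_cons ys orbT.
Qed.

Lemma nc_horner_le Q (d : R) (z : R[i]) m : (size Q <= m)%N ->
  (forall k, nc Q`_k <= d) -> nc Q.[z] <= d * \sum_(k < m) nc z ^+ k.
Proof.
move=> sQ Qd; rewrite (horner_coef_wide _ sQ) mulr_sumr.
apply: (le_trans (nc_sum _)); apply: ler_sum => k _.
by rewrite ncM ncX ler_wpM2r // exprn_ge0 ?nc_ge0.
Qed.

(* Obtained by iterating D_k = (('X - z) D)_(k+1) + z D_(k+1) downwards from the
   degree of D. *)
Fixpoint division_constant (A : R) (m : nat) : R :=
  if m is m'.+1 then 1 + A * division_constant A m' else 0.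

Lemma division_constant_ge0 A m : 0 <= A -> 0 <= division_constant A m.
Proof. by move=> A0; elim: m => //= m IH; rewrite addr_ge0 ?mulr_ge0. Qed.

Lemma nc_coef_division D (z : R[i]) (A g : R) m : nc z <= A -> 0 <= g ->
  (size D <= m)%N -> (forall k, nc (('X - z%:P) * D)`_k <= g) ->
  forall k, nc D`_k <= g * division_constant A m.
Proof.
move=> zA g0 sD Dg.
have A0 : 0 <= A := le_trans (nc_ge0 z) zA.
(* Descending induction on [k]: [l] bounds the number of possibly nonzero coefficients from index
   [k] on. *)
have H l k : (size D <= k + l)%N -> nc D`_k <= g * division_constant A l.
  elim: l k => [|l IH] k /=; first by rewrite addn0 => h; rewrite nth_default // nc0 mulr0.
  rewrite -addSnnS => /IH h.
  have -> : D`_k = (('X - z%:P) * D)`_k.+1 + z * D`_k.+1.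
    by rewrite mulrBl coefB coefXM coefCM subrK.
  apply: (le_trans (ncD _ _)); rewrite mulrDr mulr1 lerD // ncM mulrCA.
  by apply: ler_pM; rewrite ?nc_ge0.
by move=> k; apply: H; rewrite (leq_trans sD) ?leq_addl.
Qed.

(** Induction on [s]: a polynomial close to the product is small at the first root [z], hence has a
    root [z'] near [z]; dividing out ['X - z] and ['X - z'] leaves close quotients. Pairing by
    [all2] keeps track of multiplicities. *)
Lemma roots_continuous s (eta : R) : 0 < eta ->
  exists2 delta : R, 0 < delta & forall Q, Q \is monic -> size Q = (size s).+1 ->
    (forall k, nc (Q`_k - (\prod_(x <- s) ('X - x%:P))`_k) <= delta) ->
    exists2 s', Q = \prod_(x <- s') ('X - x%:P) &
      all2 (fun x y => nc (x - y) < eta) s' s.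
Proof.
move=> eta0; elim: s => [|z s [d1 d10 IH]].
  exists 1 => // Q Qm sQ _; exists [::] => //.
  have /size_poly1P [c c0 Qc] : size Q == 1%N by rewrite sQ.
  by move: Qm; rewrite big_nil Qc monicE lead_coefC => /eqP ->.
set P1 := \prod_(x <- s) ('X - x%:P) in IH *.
pose C : R := \sum_(k < (size s).+1) nc P1`_k.
pose K := division_constant (nc z + 1) (size s).+1.
pose Sz : R := \sum_(k < (size s).+2) nc z ^+ k.
have C0 : 0 <= C by apply: sumr_ge0 => k _; exact: nc_ge0.
have K0 : 0 <= K by apply: division_constant_ge0; rewrite addr_ge0 ?nc_ge0.
have Sz0 : 0 <= Sz by apply: sumr_ge0 => k _; rewrite exprn_ge0 ?nc_ge0.
have P1C k : nc P1`_k <= C.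
  have [ks|ks] := ltnP k (size s).+1.
    rewrite /C (bigD1 (Ordinal ks)) //= lerDl; apply: sumr_ge0 => ? _; exact: nc_ge0.
  by rewrite nth_default ?nc0 // size_prod_XsubC.
(* [th] is the tolerance for [z']: at most 1 to bound [nc z'], at most [eta], and small enough to
   bring the quotients within [d1]. The [+ 1] keeps the denominator positive. *)
pose th := Num.min (Num.min 1 eta) (d1 / ((1 + C) * (K + 1))).
have CK : 0 < (1 + C) * (K + 1) by apply: mulr_gt0; lra.
have th0 : 0 < th by rewrite !lt_min ltr01 eta0 divr_gt0.
have th1 : th <= 1 by rewrite !ge_min lexx.
have theta : th <= eta by rewrite !ge_min lexx orbT.
have thd1 : (1 + C) * th * K <= d1.
  have : th <= d1 / ((1 + C) * (K + 1)) by rewrite !ge_min lexx !orbT.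
  rewrite ler_pdivlMr //; apply: le_trans; rewrite mulrAC mulrC.
  by rewrite ler_wpM2l ?(ltW th0) // ler_wpM2l; lra.
(* The second bound makes the value at [z] smaller than [th ^+ (size s).+1], as [near_root]
   requires. *)
pose de := Num.min th (th ^+ (size s).+1 / (Sz + 1)).
have Sz1 : 0 < Sz + 1 by lra.
have de0 : 0 < de by rewrite lt_min th0 divr_gt0 ?exprn_gt0.
have deth : de <= th by rewrite ge_min lexx.
have deS : de * Sz < th ^+ (size s).+1.
  have : de <= th ^+ (size s).+1 / (Sz + 1) by rewrite ge_min lexx orbT.
  rewrite ler_pdivlMr //; apply: lt_le_trans.
  by rewrite ltr_pM2l // ltrDl ltr01.
exists de => // Q Qm sQ; rewrite big_cons -/P1 => QP.
set P := ('X - z%:P) * P1 in QP.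
have sP : size P = (size s).+2.
  by rewrite /P /P1 -(big_cons _ _ z s xpredT (fun x => 'X - x%:P)) size_prod_XsubC.
have [t Qt] := closed_field_poly_normal Q.
rewrite (monicP Qm) scale1r in Qt.
have st : size t = (size s).+1.
  by apply/eqP; rewrite -eqSS -(size_prod_XsubC t id) -Qt sQ.
have [z' z't zz'] : exists2 x, x \in t & nc (z - x) < th.
  apply: near_root; rewrite ?(ltW th0) // -Qt st; apply: le_lt_trans deS.
  have -> : Q.[z] = (Q - P).[z].
    by rewrite hornerD hornerN hornerM hornerXsubC subrr mul0r subr0.
  apply: nc_horner_le => [|k]; last by rewrite coefB.
  by rewrite (leq_trans (size_polyD _ _)) // size_polyN sP sQ maxnn.
have Q1 := Qt; rewrite (perm_big _ (perm_to_rem z't)) /= big_cons in Q1.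
set q := \prod_(x <- rem z' t) ('X - x%:P) in Q1.
have qm : q \is monic by apply: monic_prod_XsubC.
have sq : size q = (size s).+1 by rewrite size_prod_XsubC size_rem // st.
have [k|s' qs' s's] := IH q qm sq; last first.
  exists (z' :: s'); first by rewrite big_cons -qs'.
  by rewrite /= s's andbT ncB; exact: lt_le_trans theta.
rewrite -coefB; apply: le_trans thd1.
apply: (@nc_coef_division _ z' (nc z + 1)) => [|||l].
- have -> : z' = z - (z - z') by rewrite opprB addrC subrK.
  by apply: (le_trans (ncD _ _)); rewrite ncN lerD2l (le_trans (ltW zz')).
- by rewrite mulr_ge0 ?(ltW th0) //; lra.
- by rewrite (leq_trans (size_polyD _ _)) // size_polyN sq size_prod_XsubC maxnn.
(* The coefficients on the right are at most [th + th * C]; division by ['X - z'] costs the factor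
   [K]. *)
have -> : ('X - z'%:P) * (q - P1) = (Q - P) - (z - z')%:P * P1.
  by rewrite Q1 /P polyCB; ring.
rewrite coefB coefCM coefB [leRHS]mulrDl mul1r; apply: (le_trans (ncD _ _)).
rewrite ncN ncM lerD ?(le_trans (QP l)) // mulrC.
by apply: ler_pM; rewrite ?nc_ge0 ?P1C ?ltW.
Qed.

End RootsContinuity.

Lemma sum_count_partition (T : eqType) (n : nat) (D : nat -> pred T) (t : seq T) :
  {in t, forall x, exists2 j, (j < n)%N & D j x} ->
  (forall j k x, (j < n)%N -> (k < n)%N -> D j x -> D k x -> j = k) ->
  (\sum_(j < n) count (D j) t)%N = size t.
Proof.
move=> cov dis; elim: t cov => [|x t IH] cov /=.
  by rewrite big1.
rewrite big_split /= IH; last by move=> y yt; apply: cov; rewrite in_cons yt orbT.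
have [j jn Dj] := cov x (mem_head _ _).
rewrite (bigD1 (Ordinal jn)) //= Dj big1 ?addn0 ?add1n // => k /eqP kj.
case Dk : (D k x) => //; exfalso; apply: kj; apply: val_inj => /=.
exact: dis (ltn_ord k) jn Dk Dj.
Qed.

Lemma leq_count_all2 (S T : Type) (e : S -> T -> bool) (D' : pred S) (D : pred T) s' s :
  (forall x y, e x y -> D y -> D' x) -> all2 e s' s -> (count D s <= count D' s')%N.
Proof.
move=> H; elim: s' s => [|x s' IH] [|y s] //= /andP[exy /IH h].
by apply: leq_add => //; case Dy : (D y) => //; rewrite (H x y).
Qed.

Section Monodromy.
Variables (R : realType) (n d : nat) (h eps : R).
Variables (Q : R -> {poly R[i]}) (E : R -> R[i]).
Hypothesis n0 : (0 < n)%N.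
Hypothesis eps0 : 0 < eps.
Hypothesis Q_monic : forall phi, Q phi \is monic.
Hypothesis Q_size : forall phi, size (Q phi) = d.+1.
Hypothesis Q_cont : forall k phi0 (e : R), 0 < e ->
  \forall phi \near phi0, nc ((Q phi)`_k - (Q phi0)`_k) <= e.
Hypothesis E_cont : forall phi0 (e : R), 0 < e ->
  \forall phi \near phi0, nc (E phi - E phi0) <= e.
Hypothesis Q_periodic : forall phi, Q (phi + h) = Q phi.

Let D phi : pred R[i] := fun x => nc (x - E phi) < eps * nc (E phi).

Hypothesis root_D : forall phi x, root (Q phi) x ->
  exists2 j, (j < n)%N & D (phi + j%:R * h) x.
Hypothesis D_disjoint : forall phi j k x, (j < n)%N -> (k < n)%N ->
  D (phi + j%:R * h) x -> D (phi + k%:R * h) x -> j = k.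

(** The enumeration is arbitrary for each [phi]; only the multiset of roots matters below. *)
Let roots phi : seq R[i] := sval (closed_field_poly_normal (Q phi)).

Let Q_roots phi : Q phi = \prod_(x <- roots phi) ('X - x%:P).
Proof.
rewrite /roots; case: closed_field_poly_normal => s /= {1}->.
by rewrite (monicP (Q_monic phi)) scale1r.
Qed.

Let size_roots phi : size (roots phi) = d.
Proof.
by apply/eqP; rewrite -eqSS -(size_prod_XsubC (roots phi) id) -Q_roots Q_size.
Qed.

Let N phi := count (D phi) (roots phi).

Let D_open1 phi0 x : D phi0 x -> exists2 eta : R, 0 < eta &
  \forall phi \near phi0, forall x', nc (x' - x) < eta -> D phi x'.
Proof.
rewrite /D => Dx; set m := eps * nc (E phi0) - nc (x - E phi0).
have m0 : 0 < m by rewrite subr_gt0.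
exists (m / 2); first by rewrite divr_gt0.
(* A displacement of [E] counts once through the centre of the disc and [eps] times through its
   radius. *)
have eps1 : 0 < 1 + eps := addr_gt0 ltr01 eps0.
have e0 : 0 < m / 2 / (1 + eps) by rewrite !divr_gt0.
near=> phi => x' xx'.
have he : nc (E phi - E phi0) <= m / 2 / (1 + eps) by near: phi; exact: E_cont.
rewrite ler_pdivlMr // in he.
have h1 : nc (x' - E phi) <= nc (x' - x) + nc (x - E phi0) + nc (E phi - E phi0).
  rewrite (ncB (E phi)) (le_trans _ (lerD (ncD _ _) (lexx _))) //.
  rewrite (le_trans _ (ncD _ _)) // le_eqVlt.
  rewrite (_ : x' - E phi = x' - x + (x - E phi0) + (E phi0 - E phi)) ?eqxx //.
  by ring.
have h2 : nc (E phi0) <= nc (E phi) + nc (E phi - E phi0).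
  rewrite (ncB (E phi)) (le_trans _ (ncD _ _)) //.
  by rewrite addrC subrK.
have h3 := ler_wpM2l (ltW eps0) h2.
rewrite /m in xx' he *; nra.
Unshelve. all: by end_near. Qed.

Let D_open (phi0 : R) (s : seq R[i]) : exists2 eta : R, 0 < eta &
  \forall phi \near phi0, forall x x', x \in s -> nc (x' - x) < eta -> D phi0 x -> D phi x'.
Proof.
elim: s => [|y s [e1 e10 H1]].
  by exists 1 => //; near=> phi => x x'; rewrite in_nil.
have [Dy|nDy] := boolP (D phi0 y); last first.
  exists e1 => //; apply: filterS H1 => phi H x x'; rewrite in_cons.
  by case/orP => [/eqP -> _ Dy|]; [rewrite Dy in nDy|exact: H].
have [e2 e20 H2] := D_open1 Dy.
exists (Num.min e1 e2); first by rewrite lt_min e10.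
apply: filterS2 H1 H2 => phi H1 H2 x x'; rewrite in_cons lt_min.
by case/orP => [/eqP -> /andP[_ /H2]|xs /andP[/(H1 x x' xs)]].
Unshelve. all: by end_near. Qed.

(** Roots in the open disc stay there under a small perturbation, but others may enter from its
    boundary, so continuity of the roots alone gives only an inequality. *)
Let N_lsc (phi0 : R) : \forall phi \near phi0, (N phi0 <= N phi)%N.
Proof.
have [eta eta0 Deta] := D_open phi0 (roots phi0).
have [de de0 Hde] := roots_continuous (roots phi0) eta0.
have H : \forall phi \near phi0, forall k : 'I_d.+1, nc ((Q phi)`_k - (Q phi0)`_k) <= de.
  apply: (@filter_forall _ _
    (fun (k : 'I_d.+1) phi => nc ((Q phi)`_k - (Q phi0)`_k) <= de) (nbhs phi0) _).
  by move=> k; exact: Q_cont.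
apply: filterS2 Deta H => phi HD HQ.
have [|k|s' Qs' s's] := Hde (Q phi) (Q_monic phi).
- by rewrite Q_size size_roots.
- rewrite -Q_roots; have [kd|kd] := ltnP k d.+1; first exact: (HQ (Ordinal kd)).
  by rewrite !nth_default ?Q_size // subr0 nc0 ltW.
have Ps : perm_eq (roots phi) s' by apply: prod_XsubC_eq; rewrite -Q_roots.
rewrite /N (permP Ps).
(* The pairing must remember that [y] is a root at [phi0], because [HD] applies only to such
   points. *)
have H' : all2 (fun x y => (nc (x - y) < eta) && (y \in roots phi0)) s' (roots phi0).
  have : {subset roots phi0 <= roots phi0} by [].
  move: s's; move: {1 2 5}(roots phi0); clear; elim: s' => [|x s' IH] [|y s] //= /andP[-> h] sub.
  rewrite sub ?mem_head //= IH // => z zs; apply: sub; by rewrite in_cons zs orbT.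
by apply: leq_count_all2 H' => x y /andP[xy yr] Dy; exact: HD yr xy Dy.
Qed.

Let Q_periodicn phi j : Q (phi + j%:R * h) = Q phi.
Proof.
elim: j => [|j IH]; first by rewrite mul0r addr0.
by rewrite -natr1 mulrDl mul1r addrA Q_periodic.
Qed.

(** By periodicity all [n] counts concern the roots of the single polynomial [Q phi], each of which
    lies in exactly one disc. *)
Let sum_N phi : (\sum_(j < n) N (phi + j%:R * h))%N = d.
Proof.
rewrite -(size_roots phi) -(@sum_count_partition _ n (fun j => D (phi + j%:R * h)) (roots phi)).
- by apply: eq_bigr => j _; rewrite /N /roots Q_periodicn.
- by move=> x xr; apply: root_D; rewrite Q_roots root_prod_XsubC.
- by move=> j k x; exact: D_disjoint.
Qed.

(* The numbers N (phi + j h) are lower semicontinuous in phi and their sum is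
   the constant d. *)
Let N_loc (phi0 : R) : \forall phi \near phi0, N phi = N phi0.
Proof.
have H : \forall phi \near phi0, forall j : 'I_n,
    (N (phi0 + (nat_of_ord j)%:R * h) <= N (phi + (nat_of_ord j)%:R * h))%N.
  apply: (@filter_forall _ _ (fun (j : 'I_n) phi =>
    (N (phi0 + (nat_of_ord j)%:R * h) <= N (phi + (nat_of_ord j)%:R * h))%N) (nbhs phi0) _) => j.
  have c : (phi + j%:R * h) @[phi --> phi0] --> (phi0 + j%:R * h).
    by apply: cvgD; [exact: cvg_id|exact: cvg_cst].
  exact: c (N_lsc (phi0 + j%:R * h)).
apply: filterS H => phi H; apply/eqP; rewrite eqn_leq.
have j0 := H (Ordinal n0); rewrite /= mul0r !addr0 in j0; rewrite j0 andbT.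
have := sum_N phi; rewrite -(sum_N phi0) (bigD1 (Ordinal n0)) //=.
rewrite [RHS](bigD1 (Ordinal n0)) //= mul0r !addr0.
have : (\sum_(j < n | j != Ordinal n0) N (phi0 + (nat_of_ord j)%:R * h) <=
        \sum_(j < n | j != Ordinal n0) N (phi + (nat_of_ord j)%:R * h))%N.
  by apply: leq_sum => j _.
by move=> YX XY; have := leq_add (leqnn (N phi0)) YX; rewrite -XY leq_add2r.
Qed.

(** Connectedness of the line, used in the form that a locally constant real function has derivative
    zero. *)
Let N_cst phi : N phi = N 0.
Proof.
suff : (N phi)%:R = (N 0)%:R :> R by move/eqP; rewrite eqr_nat => /eqP.
apply: (@is_derive_0_is_cst _ (fun t : R => (N t)%:R : R)) => x.
have loc : \forall t \near x, (fun=> (N x)%:R : R) t = (N t)%:R.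
  by apply: filterS (N_loc x) => t ->.
exact: near_eq_is_derive loc (is_derive_cst _ _ _).
Qed.

Lemma dvdn_monodromy : (n %| d)%N.
Proof.
rewrite -(sum_N 0) (eq_bigr (fun=> N 0)) => [|j _]; last exact: N_cst.
by rewrite sum_nat_const card_ord dvdn_mulr.
Qed.

End Monodromy.

(** * Choice of the circle *)

Section Radius.
Variable R : realType.

Lemma sin_lipschitz (x y : R) : `|sin y - sin x| <= `|y - x|.
Proof.
wlog xy : x y / x <= y.
  move=> H; case: (leP x y) => [|/ltW] /H //.
  by rewrite distrC [X in _ <= X]distrC.
rewrite [X in _ <= X]ger0_norm ?subr_ge0 // -[X in _ <= X]mul1r.
by apply: (@real_increment_le _ _ cos) => // t _; exact: cos_max.
Qed.

(** The sine is not small at both ends of a short interval, and by the Lipschitz bound it stays away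
    from 0 near the good end. That [l'] and [eta] are independent of [A] lets [rho] grow later with
    [eta] fixed. *)
Lemma sin_away_interval (al l : R) : 0 < al -> 0 < l ->
  exists2 l' : R, 0 < l' & exists2 eta : R, 0 < eta <= 1 &
  forall A, exists2 A', A <= A' /\ A' + l' <= A + l &
    forall rho, A' <= rho <= A' + l' -> eta <= `|sin (al * rho)|.
Proof.
move=> al0 l0; pose l1 := Num.min l al^-1.
have l10 : 0 < l1 by rewrite lt_min l0 invr_gt0.
have l1l : l1 <= l by rewrite ge_min lexx.
have all1 : al * l1 <= 1.
  have : l1 <= al^-1 by rewrite ge_min lexx orbT.
  by rewrite -(ler_pM2l al0) divff ?gt_eqF.
pose s0 := sin (al * l1).
have s00 : 0 < s0.
  by apply: sin2_gt0; rewrite mulr_gt0 //=; lra.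
have s01 : s0 <= 1 := sin_le1 _.
(* Over a length [l'] the sine changes by at most [s0 / 4], so a value at least [s0 / 2] stays at
   least [s0 / 4]. *)
pose l' := Num.min l1 (s0 / 4 / al).
have l'0 : 0 < l' by rewrite lt_min l10 !divr_gt0.
have l'l1 : l' <= l1 by rewrite ge_min lexx.
have all' : al * l' <= s0 / 4.
  have : l' <= s0 / 4 / al by rewrite ge_min lexx orbT.
  by rewrite ler_pdivlMr // mulrC.
exists l' => //; exists (s0 / 4); first by lra.
have key B rho : s0 / 2 <= `|sin (al * B)| -> `|rho - B| <= l' -> s0 / 4 <= `|sin (al * rho)|.
  move=> hB hr; have := sin_lipschitz (al * rho) (al * B).
  rewrite -mulrBr normrM (gtr0_norm al0) distrC in hr * => h.
  have h2 := ler_wpM2l (ltW al0) hr.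
  have := ler_normB (sin (al * B)) (sin (al * B) - sin (al * rho)).
  rewrite subKr.
  have := ler_normD (sin (al * B) - sin (al * rho)) (sin (al * rho)).
  rewrite subrK; lra.
move=> A; have [hA|hA] := leP (s0 / 2) `|sin (al * A)|.
  exists A; first by split => //; lra.
  move=> rho hr; apply: key hA _; rewrite ger0_norm; lra.
(* As sin (al * l1) = sin (al * (A + l1) - al * A), the sine cannot be small at
   both A and A + l1. *)
have hB : s0 / 2 <= `|sin (al * (A + l1))|.
  have : s0 <= `|sin (al * (A + l1))| + `|sin (al * A)|.
    have -> : s0 = sin (al * (A + l1)) * cos (al * A) - cos (al * (A + l1)) * sin (al * A).
      by rewrite -sinB /s0; congr sin; ring.
    apply: (le_trans (ler_norm _)); apply: (le_trans (ler_normB _ _)).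
    rewrite !normrM; apply: lerD.
      by rewrite ler_piMr ?cos_max.
    by rewrite ler_piMl ?cos_max.
  lra.
exists (A + l1 - l'); first by split; lra.
move=> rho hr; apply: key hB _; rewrite distrC ger0_norm; lra.
Qed.

(** The interval is shrunk once for each frequency. *)
Lemma sin_away_intervals (al : nat -> R) (m : nat) (l : R) :
  (forall i, (i < m)%N -> 0 < al i) -> 0 < l ->
  exists2 l' : R, 0 < l' & exists2 eta : R, 0 < eta <= 1 &
  forall A, exists2 A', A <= A' /\ A' + l' <= A + l &
    forall rho i, A' <= rho <= A' + l' -> (i < m)%N -> eta <= `|sin (al i * rho)|.
Proof.
elim: m l => [|m IH] l al0 l0.
  exists l => //; exists 1; first by rewrite ltr01 lexx.
  by move=> A; exists A.
have [l1 l10 [e1 e10 H1]] := IH l (fun i im => al0 i (ltnW im)) l0.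
have [l2 l20 [e2 e20 H2]] := sin_away_interval (al0 m (ltnSn m)) l10.
exists l2 => //; exists (Num.min e1 e2).
  by rewrite lt_min ge_min; lra.
move=> A; have [A1 hA1 H1'] := H1 A; have [A2 hA2 H2'] := H2 A1.
exists A2; first by split; lra.
move=> rho i hr; rewrite ltnS leq_eqVlt ge_min => /orP[/eqP ->|im].
  by rewrite H2' ?orbT.
by rewrite H1' //; lra.
Qed.

(** If [Re z] is not small, [expR (Re z)] is already away from 1; otherwise [nc z] is close to the
    absolute value of [Im z], so the imaginary part of [cexp z] is large. The condition involves
    only [nc z], and so will not depend on the angle of [mu]. *)
Lemma cexp_sub1_ge (z : R[i]) (eta : R) : 0 < eta <= 1 ->
  eta <= `|sin (nc z)| -> eta / 4 <= nc (cexp z - 1).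
Proof.
move=> eta01 hs; set x := complex.Re z; set y := complex.Im z.
have h1 : expR x <= nc (cexp z - 1) + 1.
  by rewrite -nc_cexp -[X in nc X <= _](subrK 1) (le_trans (ncD _ _)) // nc1.
have h2 : 1 <= nc (cexp z - 1) + expR x.
  rewrite -nc_cexp ncB -[X in X <= _](nc1 R) -[X in nc X <= _](subrK (cexp z)).
  exact: ncD.
have h3 := expR_ge1Dx x; have h4 := expR_ge1Dx (- x).
have e0 := expR_gt0 x.
have h5 : expR x * expR (- x) = 1 by rewrite -expRD subrr expR0.
have [xl|xl] := leP (eta / 2) x; first by lra.
have [xr|xr] := leP x (- (eta / 2)); first by nra.
have h6 : expR x * `|sin y| <= nc (cexp z - 1).
  apply: le_trans (Im_le_nc _).
  have -> : complex.Im (cexp z - 1) = expR x * sin y.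
    by rewrite Im_addc Im_mulc /= oppr0 mul0r !addr0.
  by rewrite normrM gtr0_norm.
have h7 : `|nc z - `|y| | <= eta / 2.
  have i1 := Im_le_nc z; have i2 := nc_le_ReIm z; rewrite -/x -/y in i1 i2.
  have i3 : `|x| <= eta / 2 by rewrite ler_norml; lra.
  by rewrite ger0_norm; lra.
have h8 := sin_lipschitz `|y| (nc z).
have h9 : `|sin (nc z)| <= `|sin (nc z) - sin `|y| | + `|sin `|y| |.
  by rewrite -[X in `|X| <= _](subrK (sin `|y|)) ler_normD.
have h10 : `|sin `|y| | = `|sin y|.
  by case: (ger0P y) => // _; rewrite sinN normrN.
have h11 : eta / 2 <= `|sin y| by lra.
(* Here [expR x >= 1 + x > 1 / 2], and the sine contributes [eta / 2]. *)
nra.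
Qed.

Lemma Cx_dnbhs (z : Cx R) (P : Cx R -> Prop) :
  (\forall w \near z^', P w) ->
  exists2 e : R, 0 < e & forall w : R[i], nc (w - z) < e -> w != z -> P w.
Proof.
rewrite near_withinE => /nbhs_ballP [e /= e0 H].
(* The radius lives in [R[i]]; being positive, it is real. *)
have er : e = (complex.Re e)%:C%C by rewrite RRe_real // gtr0_real.
exists (complex.Re e); first by rewrite -ltcR -er.
move=> w wz; apply: H; rewrite -ball_normE /ball_ /= distrC er.
by rewrite normr_ncE ltcR.
Qed.

Lemma cis_lipschitz (x y : R) : nc (cis y - cis x) <= 2 * `|y - x|.
Proof.
wlog xy : x y / x <= y.
  move=> H; case: (leP x y) => [|/ltW] /H //.
  by rewrite ncB distrC.
have cisE (t : R) : cis t = cexp (Complex 0 1 * t%:C%C).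
  by rewrite cexpE Re_mulc Im_mulc /= !mul0r mulr0 subr0 expR0 mul1r add0r mul1r.
rewrite ger0_norm ?subr_ge0 // !cisE -[2]mulr1.
apply: (@increment_le _ (fun t => cexp (Complex 0 1 * t%:C%C))) => // [t|t _].
  exact: is_cder_cexp.
rewrite ncM -cisE nc_cis mulr1 ncE /= expr0n expr1n add0r sqrtr1.
exact: lexx.
Qed.

Lemma cis_reduce (x : R) : exists2 t : R, 0 <= t <= 2 * pi & cis x = cis t.
Proof.
have p0 := pi_gt0 R; have p20 : 0 < 2 * (pi : R) by rewrite mulr_gt0.
have cisn (t : R) k : cis (t + k%:R * (2 * pi)) = cis t.
  by rewrite cisD -cisX cis2pi expr1n mulr1.
pose k := Num.floor (x / (2 * pi)).
have /andP[k1 k2] : k%:~R <= x / (2 * pi) < (k + 1)%:~R.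
  by rewrite Num.Theory.floor_itv.
exists (x - k%:~R * (2 * pi)).
  rewrite ler_pdivlMr // in k1; rewrite ltr_pdivrMr // intrD mulrDl mul1r in k2.
  lra.
case: k {k1 k2} => k; first by rewrite -{1}[x](subrK (k%:R * (2 * pi))) cisn.
by rewrite NegzE mulrNz mulNr opprK cisn.
Qed.

(** Each point of the circle of radius [rho0 ^+ n] has a punctured neighbourhood free of [S], and
    nearby points with [rho != rho0] avoid its centre because their modulus differs. Compactness of
    the angle interval makes the neighbourhood of [rho0] uniform. *)
Lemma circle_avoids (S : set (Cx R)) (n : nat) (rho0 : R) : (0 < n)%N -> 0 < rho0 ->
  closed_discrete S ->
  \forall rho \near rho0^', forall th : R, ~ S ((rho ^+ n)%:C%C * cis th).
Proof.
move=> n0 r0 dS.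
have /compact_near_coveringP cov := @segment_compact R 0 (2 * pi).
have := cov _ (rho0^') (fun rho th => ~ S ((rho ^+ n)%:C%C * cis th)) _.
move=> /(_ _) H; have {H} : \forall rho \near rho0^', `[0, 2 * pi] `<=` 
   (fun th => ~ S ((rho ^+ n)%:C%C * cis th)).
  apply: H => th0 _.
  have [e e0 He] := Cx_dnbhs (dS ((rho0 ^+ n)%:C%C * cis th0)).
  have rn0 : 0 < rho0 ^+ n by rewrite exprn_gt0.
  (* One half of [e] is for the radial displacement; the second halving compensates the Lipschitz
     constant 2 of [cis]. *)
  have d0 : 0 < e / 2 / 2 / rho0 ^+ n by rewrite !divr_gt0.
  have N1 : \forall rho \near rho0^', [/\ `|rho ^+ n - rho0 ^+ n| < e / 2, 0 < rho & rho != rho0].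
    have c : (rho ^+ n) @[rho --> rho0] --> rho0 ^+ n by apply: exprn_continuous.
    near=> rho; split.
    - rewrite distrC; near: rho; apply: nbhs_dnbhs.
      by move/cvgrPdist_lt : c; apply; rewrite divr_gt0.
    - near: rho; apply: nbhs_dnbhs; exact: lt_nbhsr.
    - near: rho; exact: nbhs_dnbhs_neq.
  have N2 : \forall th \near th0, `|th - th0| < e / 2 / 2 / rho0 ^+ n.
    by near=> th; rewrite distrC; near: th; exact: nbhsx_ballx.
  exists ([set th | `|th - th0| < e / 2 / 2 / rho0 ^+ n],
          [set rho | [/\ `|rho ^+ n - rho0 ^+ n| < e / 2, 0 < rho & rho != rho0]]); first by split.
  move=> [th rho] /= [hth [hr rp rn]]; apply: He.
    have -> : (rho ^+ n)%:C%C * cis th - (rho0 ^+ n)%:C%C * cis th0 =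
      (rho ^+ n - rho0 ^+ n)%:C%C * cis th + (rho0 ^+ n)%:C%C * (cis th - cis th0).
      by rewrite rmorphB /=; ring.
    apply: (le_lt_trans (ncD _ _)); rewrite !ncM nc_cis !nc_real mulr1 (gtr0_norm rn0).
    have := cis_lipschitz th0 th.
    move/(ler_wpM2l (ltW rn0)) => h.
    rewrite ltr_pdivlMr // in hth; nra.
  apply/negP => /eqP /(congr1 (@nc R)); rewrite !ncM !nc_cis !mulr1 !nc_real.
  rewrite !gtr0_norm ?exprn_gt0 // => /eqP.
  by rewrite eqrXn2 ?(ltW rp) ?(ltW r0) // (negbTE rn).
apply: filterS => rho H th.
have [t tp ->] := cis_reduce th.
by apply: H; rewrite /= in_itv.
Unshelve. all: by end_near. Qed.

End Radius.

(** * Irreducibility *)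

Section Floquet.
Variable R : realType.

Lemma cdifferentiable_is_cder (f : R -> R[i]) (x : R) :
  cdifferentiable f -> is_cder f x (cder f x).
Proof.
move=> df; have [dr di] := df x.
by split; apply: DeriveDef => //=; rewrite derive1E.
Qed.

Lemma bounded_on_segment (p : nat -> R -> R[i]) (m : nat) (b : R) : 0 <= b ->
  (forall k, (k < m)%N -> cdifferentiable (p k)) ->
  exists2 P : R, 0 <= P & forall k x, (k < m)%N -> 0 <= x <= b -> nc (p k x) <= P.
Proof.
move=> b0; elim: m => [|m IH] dp; first by exists 0.
have [P P0 HP] := IH (fun k km => dp k (ltnW km)).
have cm := is_cder_continuous (fun x => cdifferentiable_is_cder x (dp m (ltnSn m))).
have [c cb cmax] := EVT_max b0 (continuous_subspaceT cm).
exists (P + nc (p m c)); first by rewrite addr_ge0 ?nc_ge0.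
move=> k x; rewrite ltnS leq_eqVlt => /orP[/eqP ->|km] xb.
  by rewrite (le_trans (cmax x _)) ?in_itv // lerDr.
by rewrite (le_trans (HP k x km xb)) // lerDl nc_ge0.
Qed.

Lemma char_poly_root_colvec (m : nat) (A : 'M[R[i]]_m) x : root (char_poly A) x ->
  exists2 v : 'I_m -> R[i], exists j, v j != 0 &
    forall i, \sum_j A i j * v j = x * v i.
Proof.
(* [eigenvalue] refers to row vectors, hence the transpose. *)
have -> : char_poly A = char_poly A^T.
  by rewrite /char_poly -det_tr; congr (\det _); apply/matrixP => i j; rewrite !mxE eq_sym.
rewrite -eigenvalue_root_char => /eigenvalueP [v Av v0].
exists (v 0).
  by apply/existsP; apply: contraNT v0 => /existsPn H; apply/eqP/rowP => j;
    have := H j; rewrite negbK mxE => /eqP.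
move=> i; have /rowP/(_ i) := Av; rewrite !mxE => <-.
by apply: eq_bigr => j _; rewrite mxE mulrC.
Qed.

(** An eigenvector [v] of the Floquet matrix gives the solution [y 0] with initial data [v],
    multiplied by [x] over the period. Outside all discs [no_multiplier_off_discs] would force
    [v = 0]. *)
Lemma multiplier_localization (n : nat) (b : R) (p : nat -> R -> R[i])
    (u : nat -> R[i] -> R -> R[i]) (mu x : R[i]) (eps P : R) :
  (0 < n)%N -> 0 < b ->
  (forall (j : nat) (lam : R[i]), (j < n)%N -> is_Lsol n p lam (u j lam)) ->
  (forall (i j : nat) (lam : R[i]), (i < n)%N -> (j < n)%N ->
     cdern i (u j lam) 0 = (i == j)%:R) ->
  (forall k x, (k < n.-1)%N -> 0 <= x <= b -> nc (p k x) <= P) -> 0 <= P ->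
  0 < eps -> eps <= 1 -> 1 <= nc mu ->
  n%:R * (2 * b * (1 + eps^-1) * P) < nc mu ->
  root (char_poly (floquet n b u (mu ^+ n))) x ->
  exists2 j, (j < n)%N &
    nc (x - cexp (zeta R n ^+ j * mu * b%:C%C)) <
      eps * Num.max (nc x) (nc (cexp (zeta R n ^+ j * mu * b%:C%C))).
Proof.
move=> n0 b0 uL u0 pP P0 e0 e1 mu1 mul /char_poly_root_colvec [v [i vi] Tv].
apply: contrapT => H.
have sep j : (j < n)%N ->
    eps * Num.max (nc x) (nc (cexp (zeta R n ^+ j * mu * b%:C%C)))
    <= nc (x - cexp (zeta R n ^+ j * mu * b%:C%C)).
  by move=> jn; rewrite leNgt; apply/negP => h; apply: H; exists j.
pose y k t := \sum_(j < n) v j * cdern k (u j (mu ^+ n)) t.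
have dy k (t : R) : (k < n)%N -> is_cder (y k) t (y k.+1 t).
  move=> kn; apply: is_cder_sum => j; apply: is_cderZ.
  by apply: cdifferentiable_is_cder; apply: (uL j _ (ltn_ord j)).1.
have ode t : y n t + \sum_(k < n.-1) p k t * y k t = mu ^+ n * y 0%N t.
  rewrite /y mulr_sumr; under [X in _ + X]eq_bigr do rewrite mulr_sumr.
  rewrite exchange_big -big_split /=; apply: eq_bigr => j _.
  rewrite mulrCA -[RHS]/(v j * (mu ^+ n * u j (mu ^+ n) t)).
  rewrite -(uL j (mu ^+ n) (ltn_ord j)).2 mulrDr mulr_sumr; congr (_ + _).
  by apply: eq_bigr => k _; rewrite mulrCA.
have y0 (k : 'I_n) : y k 0 = v k.
  rewrite /y (bigD1 k) //= u0 // eqxx mulr1 big1 ?addr0 // => j jk.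
  by rewrite u0 // eq_sym (negbTE jk : (nat_of_ord j == k) = false) mulr0.
have yb k : (k < n)%N -> y k b = x * y k 0.
  move=> kn; rewrite (y0 (Ordinal kn)) -Tv; apply: eq_bigr => j _.
  by rewrite mxE mulrC.
move: vi; rewrite -y0.
by rewrite (no_multiplier_off_discs n0 b0 dy ode erefl mu1 pP P0 yb e0 e1 sep mul) ?eqxx.
Qed.

End Floquet.

Section Continuity.
Variable R : realType.

Lemma nc_near_ReIm (f : R -> R[i]) (x : R) :
  {for x, continuous (fun t => complex.Re (f t))} ->
  {for x, continuous (fun t => complex.Im (f t))} ->
  forall e : R, 0 < e -> \forall t \near x, nc (f t - f x) <= e.
Proof.
move=> cr ci e e0; have e20 : 0 < e / 2 by rewrite divr_gt0.
move/cvgrPdist_le/(_ _ e20) : cr => cr; move/cvgrPdist_le/(_ _ e20) : ci => ci.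
apply: filterS2 cr ci => t hr hi.
apply: (le_trans (nc_le_ReIm _)); rewrite [e in leRHS]splitr.
have -> : complex.Re (f t - f x) = - (complex.Re (f x) - complex.Re (f t)).
  by case: (f t); case: (f x) => * /=; rewrite opprB.
have -> : complex.Im (f t - f x) = - (complex.Im (f x) - complex.Im (f t)).
  by case: (f t); case: (f x) => * /=; rewrite opprB.
by rewrite !normrN lerD.
Qed.

Lemma cvg_ncP (f : R -> Cx R) (x : R) :
  (f t @[t --> x] --> f x) <->
  (forall e : R, 0 < e -> \forall t \near x, nc (f t - f x) <= e).
Proof.
split=> [/cvgrPdist_le c e e0|c].
  have /c : (0 : R[i]) < e%:C%C by rewrite ltcR.
  by apply: filterS => t; rewrite normr_ncE lecR ncB.
apply/cvgrPdist_le => e e0.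
have er : e = (complex.Re e)%:C%C by rewrite RRe_real // gtr0_real.
have /c : 0 < complex.Re e by rewrite -ltcR -er.
by apply: filterS => t h; rewrite er normr_ncE lecR ncB.
Qed.

Lemma derivable_cvg (q : Cx R -> Cx R) (lam : R -> Cx R) (x : R) :
  derivable q (lam x) 1 -> lam t @[t --> x] --> lam x ->
  q (lam t) @[t --> x] --> q (lam x).
Proof.
move=> /derivable1_diffP/differentiable_continuous cq cl.
exact: (cvg_comp _ _ cl cq).
Qed.

(** Off this set the finitely many coefficients of a factor are holomorphic, hence continuous along
    the circle. *)
Lemma closed_discrete_bad (q : nat -> Cx R -> Cx R) (S : set (Cx R)) (m : nat) :
  (forall k, meromorphic (q k)) -> closed_discrete S ->
  closed_discrete [set w | S w \/ ~ forall k : 'I_m, derivable (q k) w 1].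
Proof.
move=> mq dS z.
have H : \forall w \near z^', forall k : 'I_m, derivable (q k) w 1.
  apply: (@filter_forall _ _ (fun (k : 'I_m) w => derivable (q k) w 1) (z^') _) => k.
  have [Sk [dSk hSk _]] := mq k.
  by apply: filterS (dSk z) => w; exact: hSk.
by apply: filterS2 (dS z) H => w nS Hw [].
Qed.

End Continuity.

Section Discs.
Variable R : realType.

(** The triangle inequality bounds [nc x] by [nc (x - e) + nc e], and [eps <= 1 / 2] absorbs the
    first term. The new radius depends on the centre only. *)
Lemma relative_disc (x e : R[i]) (eps : R) : 0 < eps -> eps <= 1 / 2 ->
  nc (x - e) < eps * Num.max (nc x) (nc e) -> nc (x - e) < 2 * eps * nc e.
Proof.
move=> e0 e1; have h0 := nc_ge0 (x - e); have h2 := nc_ge0 e.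
have : nc x <= nc (x - e) + nc e by rewrite -[X in nc X <= _](subrK e) ncD.
by case: (leP (nc x) (nc e)) => h h1 h3; nra.
Qed.

(** Factoring out either exponential shows that the centres are at least [eta / 4] times each
    modulus apart, more than the sum of the radii. *)
Lemma discs_disjoint (x z w : R[i]) (eta : R) : 0 < eta <= 1 ->
  eta <= `|sin (nc (z - w))| ->
  nc (x - cexp z) < eta / 32 * nc (cexp z) ->
  nc (x - cexp w) < eta / 32 * nc (cexp w) -> False.
Proof.
move=> eta01 hs hz hw.
have k z' w' : eta <= `|sin (nc (z' - w'))| -> eta / 4 * nc (cexp w') <= nc (cexp z' - cexp w').
  move=> /(cexp_sub1_ge eta01) h.
  have -> : cexp z' - cexp w' = (cexp (z' - w') - 1) * cexp w'.
    by rewrite mulrBl mul1r -cexpD subrK.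
  by rewrite ncM ler_wpM2r ?nc_ge0.
have kz := k z w hs.
have kw : eta / 4 * nc (cexp z) <= nc (cexp z - cexp w).
  by rewrite (ncB (cexp z)); apply: k; rewrite ncB.
have : nc (cexp z - cexp w) <= nc (x - cexp z) + nc (x - cexp w).
  rewrite (ncB x (cexp z)); have -> : cexp z - cexp w = (cexp z - x) + (x - cexp w) by ring.
  exact: ncD.
have := nc_ge0 (cexp z); have := nc_ge0 (cexp w).
move: (nc (cexp z)) (nc (cexp w)) kz kw hz hw => a c.
move: (nc _) (nc _) (nc _) => s t r; nra.
Qed.

End Discs.

Section Circle.
Variables (R : realType) (n : nat) (b rho : R).
Hypothesis n0 : (0 < n)%N.

Definition circle_mu (phi : R) : R[i] := rho%:C%C * cis phi.

Definition circle_lam (phi : R) : R[i] := (rho ^+ n)%:C%C * cis (n%:R * phi).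

Definition circle_mult (phi : R) : R[i] := cexp (circle_mu phi * b%:C%C).

Let h : R := 2 * pi / n%:R.

Lemma circle_muX phi : circle_mu phi ^+ n = circle_lam phi.
Proof. by rewrite exprMn cisX -rmorphXn. Qed.

Lemma nc_circle_mu phi : 0 < rho -> nc (circle_mu phi) = rho.
Proof. by move=> r0; rewrite ncM nc_cis mulr1 nc_real gtr0_norm. Qed.

Lemma circle_muD phi j : circle_mu (phi + j%:R * h) = zeta R n ^+ j * circle_mu phi.
Proof. by rewrite /circle_mu cisD cisX mulrA mulrC. Qed.

Lemma circle_lam_periodic phi : circle_lam (phi + h) = circle_lam phi.
Proof.
have -> : phi + h = phi + 1%:R * h by rewrite mul1r.
by rewrite -!circle_muX circle_muD exprMn expr1 zetaXn // mul1r.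
Qed.

Lemma circle_lam_cont (phi0 e : R) : 0 < e ->
  \forall phi \near phi0, nc (circle_lam phi - circle_lam phi0) <= e.
Proof.
have cn : {for phi0, continuous (fun t : R => n%:R * t)}.
  by apply: cvgM; [exact: cvg_cst|exact: cvg_id].
have cc : {for phi0, continuous (fun t : R => cos (n%:R * t))}.
  exact: (continuous_comp cn (@continuous_cos R _)).
have cs : {for phi0, continuous (fun t : R => sin (n%:R * t))}.
  exact: (continuous_comp cn (@continuous_sin R _)).
apply: nc_near_ReIm.
  under [fun t => complex.Re _]funext => t do rewrite Re_mulc /cis /= mul0r subr0.
  by apply: cvgM; [exact: cvg_cst|exact: cc].
under [fun t => complex.Im _]funext => t do rewrite Im_mulc /cis /= mul0r addr0.
by apply: cvgM; [exact: cvg_cst|exact: cs].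
Qed.

Lemma circle_mult_cont (phi0 e : R) : 0 < e ->
  \forall phi \near phi0, nc (circle_mult phi - circle_mult phi0) <= e.
Proof.
pose x t : R := rho * cos t * b; pose y t : R := rho * sin t * b.
have cx : {for phi0, continuous x}.
  apply: cvgM; last exact: cvg_cst.
  by apply: cvgM; [exact: cvg_cst|exact: continuous_cos].
have cy : {for phi0, continuous y}.
  apply: cvgM; last exact: cvg_cst.
  by apply: cvgM; [exact: cvg_cst|exact: continuous_sin].
have xE t : complex.Re (circle_mu t * b%:C%C) = x t.
  by rewrite Re_mul_real Re_mulc /= mul0r subr0.
have yE t : complex.Im (circle_mu t * b%:C%C) = y t.
  by rewrite Im_mulc /= mulr0 add0r mul0r addr0.
have ce : {for phi0, continuous (fun t => expR (x t))}.
  exact: (continuous_comp cx (@continuous_expR R _)).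
have cc : {for phi0, continuous (fun t : R => cos (y t))}.
  exact: (continuous_comp cy (@continuous_cos R _)).
have cs : {for phi0, continuous (fun t : R => sin (y t))}.
  exact: (continuous_comp cy (@continuous_sin R _)).
apply: nc_near_ReIm.
  under [fun t => complex.Re _]funext => t do
    rewrite /circle_mult cexpE xE yE Re_mulc /cis /= mul0r subr0.
  by apply: cvgM; [exact: ce|exact: cc].
under [fun t => complex.Im _]funext => t do
  rewrite /circle_mult cexpE xE yE Im_mulc /cis /= mul0r addr0.
by apply: cvgM; [exact: ce|exact: cs].
Qed.

(** Since this distance is free of [phi], finitely many conditions on [rho] separate the discs on
    the whole circle. *)
Lemma nc_sub_circle_mu phi j k : 0 < rho -> 0 < b -> (j < k)%N ->
  nc (circle_mu (phi + j%:R * h) * b%:C%C - circle_mu (phi + k%:R * h) * b%:C%C)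
  = b * nc (zeta R n ^+ (k - j) - 1) * rho.
Proof.
move=> r0 b0 jk; rewrite !circle_muD ncB.
have -> : zeta R n ^+ k * circle_mu phi * b%:C%C - zeta R n ^+ j * circle_mu phi * b%:C%C
  = zeta R n ^+ j * circle_mu phi * b%:C%C * (zeta R n ^+ (k - j) - 1).
  by rewrite -{1}(subnKC (ltnW jk)) exprD; ring.
by rewrite 3!ncM nc_zetaX nc_circle_mu // nc_real gtr0_norm // mul1r; ring.
Qed.

Lemma circle_discs_disjoint phi j k x eta : 0 < rho -> 0 < b -> 0 < eta <= 1 ->
  (forall m, (0 < m < n)%N -> eta <= `|sin (b * nc (zeta R n ^+ m - 1) * rho)|) ->
  (j < n)%N -> (k < n)%N ->
  nc (x - circle_mult (phi + j%:R * h)) < eta / 32 * nc (circle_mult (phi + j%:R * h)) ->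
  nc (x - circle_mult (phi + k%:R * h)) < eta / 32 * nc (circle_mult (phi + k%:R * h)) ->
  j = k.
Proof.
move=> r0 b0 eta01 hsin.
wlog jk : j k / (j < k)%N.
  move=> H jn kn hj hk; case: (ltngtP j k) => // jk; first exact: H.
  by apply/esym; exact: H.
move=> jn kn hj hk; exfalso; apply: (discs_disjoint eta01 _ hj hk).
rewrite nc_sub_circle_mu // hsin // subn_gt0 jk /=.
exact: leq_ltn_trans (leq_subr _ _) kn.
Qed.

End Circle.

Section GoodRadius.
Variable R : realType.

(** [eta] is fixed before [K], because the lower bound required of [rho] will depend on [eta]. The
    sine conditions hold on a whole interval, and avoiding [S] is achieved close to its midpoint. *)
Lemma good_radius (n : nat) (b : R) : (0 < n)%N -> 0 < b ->
  exists2 eta : R, 0 < eta <= 1 & forall (K : R) (S : set (Cx R)), closed_discrete S ->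
  exists2 rho : R, K < rho & 0 < rho /\
    (forall phi, ~ S (circle_lam n rho phi)) /\
    (forall m, (0 < m < n)%N -> eta <= `|sin (b * nc (zeta R n ^+ m - 1) * rho)|).
Proof.
move=> n0 b0; pose al m := b * nc (zeta R n ^+ m.+1 - 1).
have al0 m : (m < n.-1)%N -> 0 < al m.
  move=> mn; rewrite mulr_gt0 // nc_gt0 subr_eq0 zetaX_neq1 //=.
  by rewrite -(prednK n0) ltnS.
have [l l0 [eta eta01 H]] := sin_away_intervals al0 ltr01.
exists eta => // K S dS.
have [A [KA _] HA] := H (Num.max K 0).
have [KA' A0] : K <= A /\ 0 <= A by move: KA; rewrite ge_max => /andP.
have r0 : 0 < A + l / 2 by lra.
have : \forall rho \near (A + l / 2)^',
    [/\ A < rho, rho < A + l & forall th : R, ~ S ((rho ^+ n)%:C%C * cis th)].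
  near=> rho; split.
  - by near: rho; apply: nbhs_dnbhs; apply: lt_nbhsr; lra.
  - by near: rho; apply: nbhs_dnbhs; apply: lt_nbhsl; lra.
  - by near: rho; exact: circle_avoids.
move=> /filter_ex [rho [hA hl hS]].
exists rho; first lra; split; first lra; split; first by move=> phi; exact: hS.
case=> // m /= mn; apply: HA; first lra.
by rewrite -ltnS (prednK n0).
Unshelve. all: by end_near. Qed.

End GoodRadius.

Theorem theorem2 (R : realType) (n : nat) (b : R)
    (p : nat -> R -> R[i]) (u : nat -> R[i] -> R -> R[i]) :
  (2 <= n)%N -> 0 < b ->
  (forall k, (k < n.-1)%N ->
     csmooth (p k) /\ forall x : R, p k (x + b) = p k x) ->
  (forall (j : nat) (lam : R[i]), (j < n)%N -> is_Lsol n p lam (u j lam)) ->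
  (forall (i j : nat) (lam : R[i]), (i < n)%N -> (j < n)%N ->
     cdern i (u j lam) 0 = (i == j)%:R) ->
  mero_irreducible n (fun lam : Cx R => char_poly (floquet n b u lam)).
Proof.
move=> n2 b0 pH uL u0 [d1 [d2 [d10 d20 dn [q [r [mq _ [S [dS PS]]]]]]]].
have n0 : (0 < n)%N := ltnW n2.
have [P P0 pP] := bounded_on_segment (ltW b0) (fun k kn => (pH k kn).1 1%N 0%N isT).
have [eta eta01 rad] := good_radius n0 b0.
(* [relative_disc] doubles the radius, and disjointness needs [eta / 32]. *)
pose e := eta / 64.
have e0 : 0 < e by rewrite /e; lra.
have e1 : e <= 1 / 2 by rewrite /e; lra.
have [rho rhoK [r0 [rhoS rhosin]]] :=
  rad (Num.max 1 (n%:R * (2 * b * (1 + e^-1) * P))) _ (closed_discrete_bad d1.+1 mq dS).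
have [rho1 rhoP] : 1 <= rho /\ n%:R * (2 * b * (1 + e^-1) * P) < rho.
  by move: rhoK; rewrite gt_max => /andP[/ltW].
pose lam := circle_lam n rho.
have facE phi : char_poly (floquet n b u (lam phi)) =
    \poly_(k < d1.+1) q k (lam phi) * \poly_(k < d2.+1) r k (lam phi).
  by apply: PS => Sphi; apply: (rhoS phi); left.
have qder phi (k : 'I_d1.+1) : derivable (q k) (lam phi) 1.
  by apply: contrapT => nd; apply: (rhoS phi); right => H; apply: nd.
(* The characteristic polynomial has degree exactly [n = d1 + d2], so the factors cannot drop in
   degree on the circle. *)
have qd0 phi : q d1 (lam phi) != 0.
  apply/negP => /eqP q0; have := size_char_poly (floquet n b u (lam phi)).
  rewrite facE => sE.
  have s1 : (size (\poly_(k < d1.+1) q k (lam phi)) <= d1)%N.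
    apply/leq_sizeP => j dj; rewrite coef_poly ltnS.
    by case: ltngtP dj => // <-.
  have s2 : (size (\poly_(k < d2.+1) r k (lam phi)) <= d2.+1)%N by exact: size_poly.
  have := size_polyMleq (\poly_(k < d1.+1) q k (lam phi)) (\poly_(k < d2.+1) r k (lam phi)).
  rewrite sE => /leq_trans/(_ (leq_pred_sum s1 s2)).
  by rewrite addnS dn ltnn.
pose Q phi := (q d1 (lam phi))^-1 *: \poly_(k < d1.+1) q k (lam phi).
have Qsize phi : size (Q phi) = d1.+1.
  by rewrite size_scale ?invr_eq0 // size_poly_eq.
have Qmonic phi : Q phi \is monic.
  by rewrite monicE lead_coefE Qsize coefZ coef_poly ltnS leqnn mulVf.
have Qcont k (phi0 : R) (ee : R) : 0 < ee ->
    \forall phi \near phi0, nc ((Q phi)`_k - (Q phi0)`_k) <= ee.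
  move=> ee0; have [kd|kd] := ltnP k d1.+1; last first.
    by near=> phi; rewrite !nth_default ?Qsize // subrr nc0 ltW.
  have clam : (lam t : Cx R) @[t --> phi0] --> (lam phi0 : Cx R).
    by apply/cvg_ncP => d; exact: circle_lam_cont.
  have cq (j : 'I_d1.+1) := derivable_cvg (qder phi0 j) clam.
  have cQ : ((q d1 (lam t))^-1 * q k (lam t) : Cx R) @[t --> phi0] -->
      ((q d1 (lam phi0))^-1 * q k (lam phi0) : Cx R).
    apply: cvgM; last exact: (cq (Ordinal kd)).
    by apply: cvgV; [exact: qd0|exact: (cq ord_max)].
  move/cvg_ncP/(_ _ ee0) : cQ; apply: filterS => phi.
  by rewrite !coefZ !coef_poly kd.
have Qper phi : Q (phi + 2 * pi / n%:R) = Q phi.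
  by rewrite /Q /lam circle_lam_periodic.
have ndvd : (n %| d1)%N.
  apply: (@dvdn_monodromy R n d1 (2 * pi / n%:R) (eta / 32) Q (circle_mult b rho)) => //.
  - by lra.
  - by move=> phi0 ee; exact: circle_mult_cont.
  - move=> phi x rx.
    have rP : root (char_poly (floquet n b u (circle_mu rho phi ^+ n))) x.
      rewrite circle_muX facE rootM; move: rx; rewrite rootZ ?invr_eq0 // => ->.
      by [].
    have [|||j jn hj] := @multiplier_localization R n b p u (circle_mu rho phi) x e P
      n0 b0 uL u0 pP P0 e0 _ _ _ rP; rewrite ?nc_circle_mu //; first by lra.
    exists j => //; rewrite /circle_mult circle_muD.
    have := relative_disc e0 e1 hj.
    by rewrite (_ : 2 * e = eta / 32) //; rewrite /e; lra.
  - move=> phi j k x jn kn; exact: (circle_discs_disjoint r0 b0 eta01 rhosin jn kn).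
(* Divisibility gives [n <= d1], against [d1 + d2 = n] with [d2] positive. *)
have := dvdn_leq d10 ndvd.
by rewrite -dn -[leqRHS]addn0 leq_add2l leqNgt d20.
Unshelve. all: by end_near. Qed.
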